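(* Fix an integer $t\ge 1$ and let $k\to\infty$. Suppose that the integers $m$ and $k$ are such that \[ t-\frac{\ln k}{\sqrt{k}} \;\le\; \frac{2m}{k} \;\le\; t-\frac{1}{\sqrt{k}\,\ln k} . \] Then, uniformly (over all such $m$), \[ C_{2m}(t,k) = \frac{1}{\sqrt{2\pi k\, s(2m/k)}}\; \frac{R_t\big(r_0(2m/k)\big)^k}{r_0(2m/k)^{2m}}\,(1+o(1)) , \] where $o(1)$ tends to $0$ as $k\to\infty$.
   Context: For non-negative integers $t<k$ and $m$, \[ C_{2m}(t,k):=\sum_{(d_1,\ldots,d_k)} \frac{1}{\prod_{i=1}^k d_i!}, \] where the sum is over all $k$-tuples of non-negative integers with $d_i\le t$ for all $i$ and $\sum_i d_i=2m$. Let $R_t(z)=\sum_{i=0}^t z^i/i!$. For $t\ge 1$ the function $r\mapsto rR_t'(r)/R_t(r)$ is strictly increasing on $(0,\infty)$, and for each $y\in(0,t)$ we let $r_0(y)$ denote the unique positive solution $r$ of $rR_t'(r)/R_t(r)=y$ (the function $r_0$ is a continuous bijection from $(0,t)$ to $(0,\infty)$). Set \[ s(y) = r_0(y)\,\frac{d}{dx}\left.\frac{xR_t'(x)}{R_t(x)}\right|_{x=r_0(y)} , \] which is positive. *)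

(* Defs.v *)
From HB Require Import structures.
From mathcomp Require Import all_boot all_order all_algebra.
From mathcomp Require Import all_classical all_reals all_analysis.
Export numFieldNormedType.Exports.

Set Implicit Arguments.
Unset Strict Implicit.
Unset Printing Implicit Defensive.

Import Order.TTheory GRing.Theory Num.Theory.

Local Open Scope classical_set_scope.
Local Open Scope ring_scope.

(* C_n(t,k): k-tuples in {0,..,t}^k are encoded as functions 'I_k -> 'I_t.+1. *)
Definition Ccount (R : realType) (n t k : nat) : R :=
  \sum_(d : {ffun 'I_k -> 'I_t.+1} | (\sum_(i < k) d i == n)%N)
    (\prod_(i < k) ((d i)`!)%:R)^-1.

Definition truncexp (R : realType) (t : nat) (z : R) : R :=
  \sum_(i < t.+1) z ^+ i / (i`!)%:R.

(* x R_t'(x) / R_t(x) *)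
Definition saddle_fun (R : realType) (t : nat) (x : R) : R :=
  x * derive1 (truncexp t) x / truncexp t x.

(* For 1 <= t and 0 < y < t the set below is a singleton; outside this range
   the value of r0 is irrelevant (0 when no solution exists). *)
Definition r0 (R : realType) (t : nat) (y : R) : R :=
  xget 0 [set r : R | 0 < r /\ saddle_fun t r = y].

Definition s_fun (R : realType) (t : nat) (y : R) : R :=
  r0 t y * derive1 (saddle_fun t) (r0 t y).

Definition saddle_approx (R : realType) (t k m : nat) : R :=
  let y := (2 * m)%:R / k%:R : R in
  (Num.sqrt (2 * pi * k%:R * s_fun t y))^-1
  * (truncexp t (r0 t y) ^+ k / r0 t y ^+ (2 * m)).

(* Main.v *)
(** Read backwards from degree t: with w = 1/z, t! w^t R_t(z) is the polynomial
    Q(w) = sum_j t(t-1)...(t-j+1) w^j = 1 + t w + t(t-1) w^2 + ..., so for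
    n = tk - 2m the count is t!^-k times the coefficient of w^n in Q^k, and in the
    window n is of order sqrt k up to a factor ln k.  Put d = n/k.
    Then k d^3 -> 0, so only the terms of degree at most 2 of Q matter, and
      [w^n] Q^k ~ C(k,n) t^n exp((1 - 1/t) k d^2)
    follows from expanding Q^k = (1 + t w + w^2 F(w))^k binomially: the coefficients
    are nonnegative, so the upper bound compares with an exponential series, and the
    lower bound keeps only the contribution of F(0) = t(t-1).
    On the other side the saddle w0 = 1/r0 satisfies w0 Q'(w0)/Q(w0) = d, whence
    t w0 = d (1 + O(d)), k s ~ n and
      k ln Q(w0) - n ln w0 = n - n ln(d/t) + (1/2 - 1/t) k d^2 + O(k d^3).
    The two sides agree by Stirling's formula for n! and
    ln (k!/(k-n)!) = n ln k - k d^2 / 2 + O(d + k d^3).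
    The constant in Stirling's formula comes from Wallis' product, obtained from
    explicit antiderivatives of the powers of sin. *)

Require Import Defs.
From HB Require Import structures.
From mathcomp Require Import all_boot all_order all_algebra.
From mathcomp Require Import all_classical all_reals all_analysis.
From mathcomp Require Import ring lra zify.
Import Order.TTheory GRing.Theory Num.Theory.
Local Open Scope classical_set_scope.
Local Open Scope ring_scope.

Set Implicit Arguments.
Unset Strict Implicit.
Unset Printing Implicit Defensive.


(** * Elementary bounds for the logarithm *)

Lemma derive_ge0_le (R : realType) (f df : R -> R) (a b : R) :
  a <= b -> (forall x, a <= x <= b -> is_derive x 1 f (df x)) ->
  (forall x, a <= x <= b -> 0 <= df x) -> f a <= f b.
Proof.
move=> ab fd df0.
have [||c cab E] := @MVT_segment R f df a b ab.
- by move=> x; rewrite in_itv/= => /andP[ax xb]; apply: fd; rewrite !ltW.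
- apply: derivable_within_continuous => x; rewrite in_itv/= => xab.
  by apply: ex_derive; exact: fd.
rewrite -subr_ge0 E mulr_ge0 ?subr_ge0// df0//.
Qed.

(** Both sides vanish at 1, so a comparison of derivatives suffices; Taylor bounds for [ln] thus
    reduce to polynomial inequalities. *)
Lemma ln_ge_horner (R : realType) (p : {poly R}) (u : R) :
  p.[1] = 0 -> (forall v, 1 <= v -> p^`().[v] <= v^-1) -> 1 <= u ->
  p.[u] <= ln u.
Proof.
move=> p1 dp u1; rewrite -subr_ge0.
have := @derive_ge0_le R ((@ln R : R -> R) - horner p) (fun v => v^-1 - p^`().[v]) 1 u u1.
rewrite !fctE p1 ln1 subr0; apply => v /andP[v1 _].
  have v0 : 0 < v by apply: lt_le_trans v1.
  have := is_derive1_ln v0.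
  have := is_derive_poly p v.
  by move=> h1 h2; apply: is_deriveB.
by rewrite subr_ge0 dp.
Qed.

Lemma ln_le_horner (R : realType) (p : {poly R}) (u : R) :
  p.[1] = 0 -> (forall v, 1 <= v -> v^-1 <= p^`().[v]) -> 1 <= u ->
  ln u <= p.[u].
Proof.
move=> p1 dp u1; rewrite -subr_ge0.
have := @derive_ge0_le R (horner p - (@ln R : R -> R)) (fun v => p^`().[v] - v^-1) 1 u u1.
rewrite !fctE p1 ln1 subr0; apply => v /andP[v1 _].
  have v0 : 0 < v by apply: lt_le_trans v1.
  have := is_derive1_ln v0.
  have := is_derive_poly p v.
  by move=> h1 h2; apply: is_deriveB.
by rewrite subr_ge0 dp.
Qed.

Lemma ln1D_ge (R : realType) (x : R) : 0 <= x -> x - x ^+ 2 / 2 <= ln (1 + x).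
Proof.
move=> x0; pose p : {poly R} := ('X - 1%:P) - 2^-1 *: ('X - 1%:P) ^+ 2.
have -> : x - x ^+ 2 / 2 = p.[1 + x] by rewrite /p !(hornerD, hornerN, hornerZ, horner_exp, hornerX, hornerC); field.
apply: ln_ge_horner; last by lra.
  by rewrite /p !(hornerD, hornerN, hornerZ, horner_exp, hornerX, hornerC); ring.
move=> v v1; rewrite /p !(derivD, derivN, deriv_exp, derivX, derivC, derivZ, hornerD, hornerN, hornerZ, hornerM, hornerMn, horner_exp, hornerX, hornerC).
have v0 : 0 < v by lra.
(* Multiplied by v, the inequality 2 - v <= 1/v reads (v - 1)^2 >= 0. *)
rewrite -[X in X <= _](mulfK (lt0r_neq0 v0)) ler_pdivrMr ?mulVf ?gt_eqF//.
by nra.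
Qed.

Lemma ln1D_le (R : realType) (x : R) : 0 <= x ->
  ln (1 + x) <= x - x ^+ 2 / 2 + x ^+ 3 / 3.
Proof.
move=> x0; pose p : {poly R} :=
  ('X - 1%:P) - 2^-1 *: ('X - 1%:P) ^+ 2 + 3^-1 *: ('X - 1%:P) ^+ 3.
have -> : x - x ^+ 2 / 2 + x ^+ 3 / 3 = p.[1 + x] by rewrite /p !(hornerD, hornerN, hornerZ, horner_exp, hornerX, hornerC); field.
apply: ln_le_horner; last by lra.
  by rewrite /p !(hornerD, hornerN, hornerZ, horner_exp, hornerX, hornerC); ring.
move=> v v1; rewrite /p !(derivD, derivN, deriv_exp, derivX, derivC, derivZ, hornerD, hornerN, hornerZ, hornerM, hornerMn, horner_exp, hornerX, hornerC).
have v0 : 0 < v by lra.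
(* Multiplied by v, the right side becomes 1 + (v - 1)^3. *)
rewrite -[X in _ <= X](mulfK (lt0r_neq0 v0)) ler_pdivlMr ?mulVf ?gt_eqF//.
by have : 0 <= (v - 1) ^+ 3 by [rewrite exprn_ge0// subr_ge0]; rewrite /=; lra.
Qed.

(** With y = x/(1 - x), ln (1 - x) = - ln (1 + y) >= - y, and y = x + x^2/(1 - x) <= x + 2 x^2 for x
    at most 1/2. *)
Lemma ln1B_ge (R : realType) (x : R) : 0 <= x <= 2^-1 ->
  - x - 2 * x ^+ 2 <= ln (1 - x).
Proof.
move=> /andP[x0 x2].
have x1 : 0 < 1 - x by lra.
have -> : 1 - x = (1 + x / (1 - x))^-1 by field; rewrite subrK oner_neq0 gt_eqF.
have y0 : 0 <= x / (1 - x) by rewrite divr_ge0// ltW.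
rewrite lnV ?posrE; last by lra.
rewrite -opprD lerN2 (le_trans (le_ln1Dx _)); [by []|by lra|].
have E : x / (1 - x) * (1 - x) = x by field; rewrite gt_eqF.
move: y0 E; set y := x / (1 - x) => y0 E; nra.
Qed.

(** * Wallis' product *)

(* The integral of sin^n over [0, pi/2]. *)
Fixpoint wallis (R : realType) (n : nat) : R :=
  match n with
  | 0 => pi / 2
  | 1 => 1
  | n'.+2 => (n'.+1)%:R / (n'.+2)%:R * wallis R n'
  end.

(** From an antiderivative F of sin^n the reduction formula gives (n+1)/(n+2) F - sin^(n+1) cos /
    (n+2) for sin^(n+2), and its second term vanishes at 0 and at pi/2. The recursion has step two,
    so the induction carries two consecutive exponents. *)
Lemma wallis_primitive (R : realType) (n : nat) : exists F : R -> R,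
  (forall x : R, is_derive x (1 : R) F (sin x ^+ n)) /\
  F (pi / 2) - F 0 = wallis R n.
Proof.
suff: (exists F : R -> R, (forall x : R, is_derive x (1 : R) F (sin x ^+ n)) /\
  F (pi / 2) - F 0 = wallis R n) /\ (exists F : R -> R,
  (forall x : R, is_derive x (1 : R) F (sin x ^+ n.+1)) /\
  F (pi / 2) - F 0 = wallis R n.+1) by case.
elim: n => [|n [[F [dF F0]] ih]].
  split; [exists id|exists (- cos)]; split.
  - by move=> x; rewrite expr0; exact: is_derive_id.
  - by rewrite subr0.
  - move=> x; rewrite expr1 -[sin x]opprK; exact: is_deriveN.
  - by rewrite !fctE cos_pihalf cos0 /= oppr0 opprK add0r.
split=> //.
pose c : R := (n.+2)%:R^-1.
exists ((n.+1%:R * c) \*: F - c \*: ((@sin R) ^+ n.+1 * (@cos R))); split.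
  move=> x; apply: is_derive_eq.
  have -> : ((@sin R) ^+ n.+1) x = sin x ^+ n.+1 by rewrite fctE.
  rewrite /GRing.scale/= !exprS.
  have /eqP := cos2sin2 x; rewrite eq_sym subr_eq => /eqP E.
  have c1 : c * n.+2%:R = 1 by rewrite mulVf ?pnatr_eq0.
  move: E c1; rewrite -[n.+2]addn1 natrD; move: (sin x ^+ n) (n.+1%:R) => S m E c1.
  rewrite -[RHS]mul1r -c1; move: (sin x) (cos x) E => a b E.
  transitivity (c * (m * S * (1 - b ^+ 2) + S * a ^+ 2)); first by ring.
  have {}E : 1 - b ^+ 2 = a ^+ 2 by rewrite E addrAC subrr add0r.
  by rewrite E; ring.
rewrite !fctE /= -F0 cos_pihalf sin0 expr0n/= mulr0 mul0r !scaler0.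
by rewrite /c !subr0 -scalerBr.
Qed.

Lemma wallis_le (R : realType) (n : nat) : wallis R n.+1 <= wallis R n.
Proof.
have [F [dF <-]] := wallis_primitive R n.
have [G [dG <-]] := wallis_primitive R n.+1.
have p0 : 0 <= pi / 2 :> R by rewrite divr_ge0// pi_ge0.
have := @derive_ge0_le R (F - G) (fun x => sin x ^+ n - sin x ^+ n.+1) 0 (pi / 2) p0.
rewrite !fctE => H; have {}H : F 0 - G 0 <= F (pi / 2) - G (pi / 2).
  apply: H => x /andP[x0 xp].
  rewrite subr_ge0 exprS ler_piMl ?sin_le1// exprn_ge0// sin_ge0_pi//.
  by rewrite x0 (le_trans xp)// ler_pdivrMr// ler_peMr ?pi_ge0// ler1n.
by rewrite lerBrDr addrAC lerBlDr; lra.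
Qed.

(** The recursion leaves this product invariant; together with [wallis_le] it determines n W(n)^2
    asymptotically. *)
Lemma wallis_mul (R : realType) (n : nat) :
  n.+1%:R * wallis R n.+1 * wallis R n = pi / 2.
Proof.
elim: n => [|n ih]; first by rewrite /= !mul1r.
have : n.+2%:R != 0 :> R by rewrite pnatr_eq0.
by rewrite -ih /=; move: (n.+1%:R) (n.+2%:R) => a b b0; field.
Qed.

Lemma wallis_gt0 (R : realType) (n : nat) : 0 < wallis R n.
Proof.
suff: 0 < wallis R n /\ 0 < wallis R n.+1 by case.
elim: n => [|n [h1 h2]]; first by rewrite /= divr_gt0 ?pi_gt0.
by split=> //=; rewrite !mulr_gt0// ?invr_gt0 ltr0n.
Qed.

(** The quotient is the central binomial coefficient over 4^n: this links Wallis' product to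
    factorials. *)
Lemma wallis_even (R : realType) (n : nat) :
  wallis R n.*2 = pi / 2 * ((n.*2)`!%:R / (4 ^+ n * n`!%:R ^+ 2)).
Proof.
elim: n => [|n ih]; first by rewrite /= expr0 expr1n mulr1 divr1 mulr1.
rewrite doubleS /= ih !factS !natrM [4 ^+ n.+1]exprS.
have h : (n.*2.+2)%:R = 2 * n.+1%:R :> R by rewrite -natrM mul2n.
have f0 : n`!%:R != 0 :> R by rewrite pnatr_eq0 -lt0n fact_gt0.
have p0 : 4 ^+ n != 0 :> R by rewrite expf_neq0// pnatr_eq0.
have : n.+1%:R != 0 :> R by rewrite pnatr_eq0.
rewrite h; move: f0 p0 (n.+1%:R) => f0 p0 m m0.
by field; rewrite f0 p0 m0.
Qed.

(** * Stirling's formula *)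

(** The logarithm of n! e^n / n^(n + 1/2). *)
Definition stirling_seq (R : realType) (n : nat) : R :=
  ln n`!%:R - (n%:R + 2^-1) * ln n%:R + n%:R.

(** With x = 1/(n+1) the difference is (1/x + 1/2) ln (1 + x) - 1, which the Taylor bounds confine
    to [-x^2/4, x^2/4]. The telescoping right side equals x^2 / (2 (1 + x)) >= x^2/4. *)
Lemma stirling_step (R : realType) (n : nat) :
  `|stirling_seq R n.+1 - stirling_seq R n.+2| <=
    2^-1 * ((n.+1%:R)^-1 - (n.+2%:R)^-1).
Proof.
pose x : R := (n.+1%:R)^-1.
have x0 : 0 < x by rewrite invr_gt0 ltr0n.
have x1 : x <= 1 by rewrite invf_le1 ?ltr0n// ler1n.
have xn : n.+1%:R * x = 1 by rewrite mulfV ?pnatr_eq0.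
have n2 : n.+2%:R = n.+1%:R * (1 + x) :> R by rewrite mulrDr xn mulr1 -natr1.
have n1 : 0 < n.+1%:R :> R by rewrite ltr0n.
have -> : stirling_seq R n.+1 - stirling_seq R n.+2 =
    (n.+1%:R + 2^-1) * ln (1 + x) - 1.
  rewrite /stirling_seq [n.+2`!]factS natrM lnM ?posrE ?ltr0n ?fact_gt0//.
  rewrite n2 lnM ?posrE//; last by lra.
  by rewrite [_ * (1 + x)]mulrDr xn mulr1; field.
rewrite n2 invfM -/x.
have := ln1D_ge (ltW x0); have := ln1D_le (ltW x0).
move: (ln (1 + x)) => l u v.
have -> : x - x * (1 + x)^-1 = x ^+ 2 / (1 + x) by field; lra.
have h1 : x ^+ 2 / 2 <= x ^+ 2 / (1 + x).
  by rewrite ler_wpM2l ?sqr_ge0// lef_pV2 ?posrE; lra.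
rewrite ler_norml; apply/andP; split.
- have : (n.+1%:R + 2^-1) * (x - x ^+ 2 / 2) <= (n.+1%:R + 2^-1) * l.
    by rewrite ler_wpM2l//; lra.
  have -> : (n.+1%:R + 2^-1) * (x - x ^+ 2 / 2) = 1 - x ^+ 2 / 4.
    rewrite mulrDl mulrBr xn.
    have -> : n.+1%:R * (x ^+ 2 / 2) = (n.+1%:R * x) * x / 2 by field.
    by rewrite xn; field.
  by lra.
- have : (n.+1%:R + 2^-1) * l <= (n.+1%:R + 2^-1) * (x - x ^+ 2 / 2 + x ^+ 3 / 3).
    by rewrite ler_wpM2l//; lra.
  have -> : (n.+1%:R + 2^-1) * (x - x ^+ 2 / 2 + x ^+ 3 / 3) =
     1 + x ^+ 2 / 12 + x ^+ 3 / 6.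
    transitivity (n.+1%:R * x * (1 - x / 2 + x ^+ 2 / 3)
      + 2^-1 * (x - x ^+ 2 / 2 + x ^+ 3 / 3)); first by field.
    by rewrite xn; field.
  have : x ^+ 3 <= x ^+ 2 by rewrite ler_wiXn2l// ltW.
  by lra.
Qed.

(** By the telescoping bound, adding 1/(2(n+1)) to the shifted sequence makes it nonincreasing, and
    subtracting it makes it nondecreasing; the second sequence bounds the first from below. *)
Lemma stirling_seq_is_cvg (R : realType) :
  exists l : R, stirling_seq R n @[n --> \oo] --> l.
Proof.
pose v n := stirling_seq R n.+1 - 2^-1 * harmonic n.
pose u n := stirling_seq R n.+1 + 2^-1 * harmonic n.
have step n : u n.+1 <= u n /\ v n <= v n.+1.
  have := stirling_step R n; rewrite ler_norml /u /v /harmonic/=.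
  by move: n.+1%:R^-1 n.+2%:R^-1 => a b /andP[? ?]; split; lra.
have u_noninc : nonincreasing_seq u.
  by apply/nonincreasing_seqP => n; have [] := step n.
have v_nondec : nondecreasing_seq v.
  by apply/nondecreasing_seqP => n; have [] := step n.
have vu n : v n <= u n.
  by rewrite /u /v lerD2l ge0_cp ?mulr_ge0// ?invr_ge0.
have : cvgn u.
  apply: nonincreasing_is_cvgn => //; exists (v 0) => _ [n _ <-].
  by rewrite (le_trans _ (vu n))// v_nondec.
move=> /cvg_ex [l ul]; exists l.
rewrite -(cvg_shiftS (stirling_seq R)).
have -> : (fun n => stirling_seq R n.+1) = u - (fun n => 2^-1 * harmonic n).
  by apply/funext => n; rewrite fctE /u addrK.
rewrite -[l]subr0; apply: cvgB => //.
by rewrite -[0](mulr0 2^-1); apply: cvgMr; exact: cvg_harmonic.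
Qed.

(** In S(2n) - 2 S(n) everything cancels except ln (n W(2n)^2) and constants. Monotonicity and the
    invariant product place n W(2n)^2 between (pi/4) / (1 + 1/(2n)) and pi/4. *)
Lemma stirling_double (R : realType) (n : nat) : (0 < n)%N ->
  - ln (2 * pi) - (2 * n%:R)^-1 <=
    2 * (stirling_seq R n.*2 - 2 * stirling_seq R n) <= - ln (2 * pi).
Proof.
move=> n0; have n0' : 0 < n%:R :> R by rewrite ltr0n.
have pi0 : 0 < pi :> R := pi_gt0 R.
pose W := wallis R n.*2.
have W0 : 0 < W := wallis_gt0 R _.
have lnW : ln W = ln (pi / 2) + (ln (n.*2)`!%:R - (n%:R * ln 4 + 2 * ln n`!%:R)).
  rewrite /W wallis_even lnM ?posrE ?divr_gt0 ?mulr_gt0 ?exprn_gt0 ?ltr0n ?fact_gt0//.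
  rewrite [ln (_ / (_ * _))]ln_div ?posrE ?mulr_gt0 ?exprn_gt0 ?ltr0n ?fact_gt0//.
  rewrite [ln (_ ^+ _ * _)]lnM ?posrE ?exprn_gt0 ?ltr0n ?fact_gt0// !lnXn ?ltr0n ?fact_gt0//.
  by rewrite !mulr_natl.
have ln4 : ln 4 = 2 * ln 2 :> R.
  by rewrite (_ : 4 = 2 * 2) ?lnM ?posrE//; [ring|rewrite -natrM].
have lnp2 : ln (pi / 2) = ln pi - ln 2 :> R by rewrite ln_div ?posrE.
have ln2p : ln (2 * pi) = ln 2 + ln pi :> R by rewrite lnM ?posrE.
have n2 : (n.*2)%:R = 2 * n%:R :> R by rewrite -mul2n natrM.
have -> : 2 * (stirling_seq R n.*2 - 2 * stirling_seq R n) =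
   ln (W ^+ 2 * n%:R) - 2 * ln (pi / 2) - ln 2.
  rewrite lnM ?posrE ?exprn_gt0// lnXn// lnW /stirling_seq n2.
  by rewrite lnM ?posrE// ln4 mulr2n; field.
have up : ln (W ^+ 2 * n%:R) <= ln (pi / 2 / 2).
  rewrite ler_ln ?posrE ?mulr_gt0 ?divr_gt0 ?exprn_gt0//.
  rewrite ler_pdivlMr// -(wallis_mul R n.*2.-1) prednK ?double_gt0//.
  rewrite n2 expr2 -/W.
  have : W * W <= W * wallis R n.*2.-1.
    by rewrite ler_pM2l//; have := wallis_le R n.*2.-1; rewrite prednK ?double_gt0.
  move: (wallis R n.*2.-1) => w h.
  have : n%:R * (W * W) <= n%:R * (W * w) by rewrite ler_pM2l.
  by lra.
have h0 : 0 < (2 * n%:R)^-1 :> R by rewrite invr_gt0 mulr_gt0.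
have h1 : 0 < 1 + (2 * n%:R)^-1 :> R by rewrite addr_gt0.
have lo : ln (pi / 2 / 2) - (2 * n%:R)^-1 <= ln (W ^+ 2 * n%:R).
  have : ln (pi / 2) <= ln (W ^+ 2 * n%:R * (2 * (1 + (2 * n%:R)^-1))).
    rewrite ler_ln ?posrE ?mulr_gt0 ?divr_gt0 ?exprn_gt0//.
    rewrite -(wallis_mul R n.*2) -natr1 n2 -/W.
    have : W * wallis R n.*2.+1 <= W * W by rewrite ler_pM2l// wallis_le.
    move: (wallis R _) => w h.
    have -> : W ^+ 2 * n%:R * (2 * (1 + (2 * n%:R)^-1)) = (2 * n%:R + 1) * (W * W).
      by field; rewrite gt_eqF.
    have : (2 * n%:R + 1) * (W * w) <= (2 * n%:R + 1) * (W * W).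
      by rewrite ler_pM2l//; lra.
    by lra.
  rewrite [ln (_ * (2 * _))]lnM ?posrE ?mulr_gt0 ?exprn_gt0//.
  rewrite [ln (2 * (1 + _))]lnM ?posrE//.
  rewrite [ln (pi / 2 / 2)]ln_div ?posrE ?divr_gt0//.
  have : ln (1 + (2 * n%:R)^-1) <= (2 * n%:R)^-1 :> R.
    by rewrite le_ln1Dx// (lt_trans _ h0).
  by move: (2 * n%:R)^-1 => z; lra.
move: up lo; rewrite [ln (pi / 2 / 2)]ln_div ?posrE ?divr_gt0//.
rewrite lnp2 ln2p; clear; move: (2 * n%:R)^-1 (ln (W ^+ 2 * n%:R)) => z w u l.
by apply/andP; split; lra.
Qed.

(** A limit l is also the limit along doubled indices, so 2 (l - 2 l) = - ln (2 pi), which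
    determines l. *)
Lemma stirling_cvg (R : realType) :
  stirling_seq R n @[n --> \oo] --> (ln (2 * pi) / 2 : R).
Proof.
have [l Sl] := stirling_seq_is_cvg R.
suff -> : ln (2 * pi) / 2 = l by [].
have dbl : n.*2 @[n --> \oo] --> \oo.
  apply/cvgnyPge => A; near=> n; rewrite -addnn (@leq_trans n)// ?leq_addr//.
  by near: n; exact: nbhs_infty_ge.
have S2 : stirling_seq R n.*2 @[n --> \oo] --> l by apply: cvg_comp Sl.
have : 2 * (stirling_seq R n.*2 - 2 * stirling_seq R n) @[n --> \oo] --> 2 * (l - 2 * l).
  by apply: cvgMr; apply: cvgB => //; exact: cvgMr.
have H : 2 * (stirling_seq R n.*2 - 2 * stirling_seq R n) @[n --> \oo] --> - ln (2 * pi : R).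
  apply: (@squeeze_cvgr _ _ _ _ (fun n => - ln (2 * pi : R) - 2^-1 * n%:R^-1) (cst (- ln (2 * pi)))).
  - near=> n; rewrite -invfM; apply: stirling_double.
    by near: n; exact: nbhs_infty_gt.
  - rewrite -[X in _ --> X]subr0; apply: cvgB; first exact: cvg_cst.
    rewrite -[0](mulr0 2^-1); apply: cvgMr.
    by rewrite -(cvg_shiftS (fun i : nat => i%:R^-1 : R)); exact: cvg_harmonic.
  - exact: cvg_cst.
move=> H'; have : - ln (2 * pi) = 2 * (l - 2 * l).
  by apply: cvg_unique H H'; exact: Rhausdorff.
by clear; lra.
Unshelve. all: by end_near.
Qed.

Lemma ln_fact_stirling (R : realType) (e : R) : 0 < e ->
  \forall n \near \oo, `|ln n`!%:R - (ln (2 * pi * n%:R) / 2 + n%:R * ln n%:R - n%:R)| <= e.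
Proof.
move=> e0; have /cvgrPdist_le/(_ e e0) := @stirling_cvg R.
apply: filter_app; near=> n.
have n0 : (0 < n)%N by near: n; exact: nbhs_infty_gt.
rewrite distrC [ln (_ * n%:R)]lnM ?posrE ?mulr_gt0 ?pi_gt0 ?ltr0n//.
congr (`|_| <= e); rewrite /stirling_seq; field.
Unshelve. all: by end_near.
Qed.

(** * Partial sums of the exponential series *)

Lemma expR_ge_sum (R : realType) (x : R) (n : nat) : 0 <= x ->
  \sum_(l < n) x ^+ l / l`!%:R <= expR x.
Proof.
move=> x0; have : series (exp_coeff x) n <= expR x.
  apply: nondecreasing_cvgn_le; last exact: is_cvg_series_exp_coeff.
  apply/nondecreasing_seqP => m; rewrite -subr_ge0 seriesSB.
  by rewrite /exp_coeff/= divr_ge0// exprn_ge0.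
by rewrite /series/= /exp_coeff/= big_mkord.
Qed.

Lemma expR_le_sum (R : realType) (x c : R) (m : nat) :
  (forall n, (m <= n)%N -> \sum_(l < n) x ^+ l / l`!%:R <= c) -> expR x <= c.
Proof.
move=> h; apply: limr_le; first exact: is_cvg_series_exp_coeff.
near=> n; rewrite /series/= /exp_coeff/= big_mkord; apply: h.
by near: n; exact: nbhs_infty_ge.
Unshelve. all: by end_near. Qed.

(** Up to the factor e^x this is the second moment of a Poisson law. Writing l^2 = l (l - 1) + l and
    shifting indices leaves shorter partial sums of e^x. *)
Lemma sum_sqr_exp_le (R : realType) (x : R) (n : nat) : 0 <= x ->
  \sum_(l < n) l%:R ^+ 2 * (x ^+ l / l`!%:R) <= (x ^+ 2 + x) * expR x.
Proof.
move=> x0; pose g m := \sum_(l < m) x ^+ l / l`!%:R.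
have : \sum_(l < n) l%:R ^+ 2 * (x ^+ l / l`!%:R) <= x ^+ 2 * g n.-2 + x * g n.-1.
  case: n => [|n]; first by rewrite /g/= !big_ord0 !mulr0 addr0.
  have E : \sum_(l < n.+1) l%:R ^+ 2 * (x ^+ l / l`!%:R) =
      x * \sum_(l < n) (l%:R + 1) * (x ^+ l / l`!%:R).
    rewrite big_ord_recl/= expr0n/= mul0r add0r big_distrr/=; apply: eq_bigr => i _.
    rewrite /bump/= add1n [x ^+ _.+1]exprS factS natrM -natr1.
    have : i`!%:R != 0 :> R by rewrite pnatr_eq0 -lt0n fact_gt0.
    have : i%:R + 1 != 0 :> R by rewrite natr1 pnatr_eq0.
    by move=> ? ?; field; apply/andP.
  rewrite E /=; case: n {E} => [|n]; first by rewrite /g/= !big_ord0 !mulr0 addr0.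
  rewrite expr2 -mulrA -mulrDr ler_wpM2l//.
  under eq_bigr do rewrite mulrDl mul1r.
  rewrite big_split/= lerD2r.
  rewrite big_ord_recl/= mul0r add0r /g big_distrr/= le_eqVlt; apply/orP; left.
  apply/eqP; apply: eq_bigr => i _.
  rewrite /bump/= add1n [x ^+ _.+1]exprS factS natrM.
  have : i`!%:R != 0 :> R by rewrite pnatr_eq0 -lt0n fact_gt0.
  have : i.+1%:R != 0 :> R by rewrite pnatr_eq0.
  by move: (i.+1%:R) (i`!%:R) => a b ? ?; field; apply/andP.
move=> /le_trans; apply; rewrite mulrDl lerD// ler_wpM2l ?sqr_ge0//;
 exact: expR_ge_sum.
Qed.

(** * Binomial inequalities and coefficients of powers of 1 + a X + E *)

Lemma ffact_le_expn (k l : nat) : (k ^_ l <= k ^ l)%N.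
Proof.
by elim: l => // l ih; rewrite ffactnSr expnSr leq_mul// leq_subr.
Qed.

Lemma bin_mul_le (k l i : nat) : ('C(k, l) * 'C(k - l, i) * l`! <= k ^ l * 'C(k, i))%N.
Proof.
rewrite mulnAC bin_ffact leq_mul ?leq_bin2l ?leq_subr//.
exact: ffact_le_expn.
Qed.

(** Passing from C(k, i+1) to C(k, i) multiplies by (i+1)/(k-i), which is at most n/(k-n) when i < n
    < k. *)
Lemma bin_sub_le (k n j : nat) : (j <= n <= k)%N ->
  ('C(k, n - j) * (k - n) ^ j <= 'C(k, n) * n ^ j)%N.
Proof.
elim: j => [|j ih] /andP[jn nk]; first by rewrite subn0.
have {}ih := ih _; rewrite (ltnW jn) nk in ih; have {}ih := ih isT.
rewrite [(n ^ j.+1)%N]expnSr mulnA.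
apply: (@leq_trans ('C(k, n - j) * (k - n) ^ j * n)); last by rewrite leq_mul2r ih orbT.
rewrite expnSr mulnA mulnAC [X in (_ <= X)%N]mulnAC leq_mul2r; apply/orP; right.
apply: (@leq_trans ('C(k, n - j) * (n - j))); last by rewrite leq_mul2l leq_subr orbT.
have E : (n - j = (n - j.+1).+1)%N by rewrite -subSn.
rewrite E [X in (_ <= X)%N]mulnC mul_bin_left mulnC leq_mul2r.
by apply/orP; right; lia.
Qed.

Lemma coef_exp1D (R : realType) (a : R) (m i : nat) :
  ((1 + a *: 'X) ^+ m)`_i = 'C(m, i)%:R * a ^+ i.
Proof.
rewrite addrC exprD1n.
under eq_bigr => j _ do rewrite exprZn scalerMnl.
rewrite -(poly_def m.+1 (fun j => a ^+ j *+ 'C(m, j))) coef_poly ltnS.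
by case: leqP => [_|mi]; [rewrite mulr_natl|rewrite bin_small// mul0r].
Qed.

Lemma coef_exp1DD (R : realType) (a : R) (E : {poly R}) (k n : nat) :
  ((1 + a *: 'X + E) ^+ k)`_n =
  \sum_(l < k.+1) \sum_(j < n.+1)
     (E ^+ l)`_j * ('C(k, l) * 'C(k - l, n - j))%:R * a ^+ (n - j).
Proof.
rewrite exprDn coef_sum; apply: eq_bigr => l _.
rewrite coefMn mulrC coefM -sumrMnl; apply: eq_bigr => j _.
by rewrite coef_exp1D -mulr_natl natrM; ring.
Qed.

Lemma sum_coef_le_horner (R : realType) (p : {poly R}) (n : nat) (x : R) :
  (forall i, 0 <= p`_i) -> 0 <= x -> \sum_(j < n) p`_j * x ^+ j <= p.[x].
Proof.
move=> p0 x0; rewrite (horner_coef_wide x (leq_maxr n (size p))).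
rewrite (big_ord_widen (maxn n (size p)) (fun j => p`_j * x ^+ j)) ?leq_maxl//.
by rewrite big_mkcond/=; apply: ler_sum => i _; case: ifP => // _; rewrite mulr_ge0// exprn_ge0.
Qed.

Lemma coef_exp_ge0 (R : realType) (p : {poly R}) (l j : nat) :
  (forall i, 0 <= p`_i) -> 0 <= (p ^+ l)`_j.
Proof.
move=> p0; elim: l j => [|l ih] j; first by rewrite expr0 coef1 ler0n.
by rewrite exprS coefM sumr_ge0// => i _; rewrite mulr_ge0.
Qed.

(** The point w = n / (a (k - n)) is the saddle of (1 + a X)^k / X^n. By [bin_mul_le] and
    [bin_sub_le] each term of the double sum is at most C(k,n) a^n (k^l / l!) times the term of
    degree j of E^l at w; summing over j gives E(w)^l, and summing over l an exponential series. *)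
Lemma coef_exp1DD_le (R : realType) (a : R) (E : {poly R}) (k n : nat) :
  0 < a -> (forall i, 0 <= E`_i) -> (n < k)%N ->
  ((1 + a *: 'X + E) ^+ k)`_n <=
  'C(k, n)%:R * a ^+ n * expR (k%:R * E.[n%:R / (a * (k - n)%:R)]).
Proof.
move=> a0 E0 nk; set w := n%:R / _.
have kn0 : 0 < (k - n)%:R :> R by rewrite ltr0n subn_gt0.
have w0 : 0 <= w by rewrite divr_ge0// mulr_ge0// ltW.
have Ew0 : 0 <= E.[w].
  by rewrite (le_trans _ (sum_coef_le_horner 0 E0 w0))// big_ord0.
rewrite coef_exp1DD; apply: (@le_trans _ _ (\sum_(l < k.+1)
    'C(k, n)%:R * a ^+ n * ((k%:R * E.[w]) ^+ l / l`!%:R))); last first.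
  rewrite -big_distrr/= ler_wpM2l ?mulr_ge0 ?exprn_ge0 ?(ltW a0)//.
  by apply: expR_ge_sum; rewrite mulr_ge0.
apply: ler_sum => l _.
have lf0 : 0 < l`!%:R :> R by rewrite ltr0n fact_gt0.
apply: (@le_trans _ _ (\sum_(j < n.+1)
  'C(k, n)%:R * a ^+ n * (k%:R ^+ l / l`!%:R) * ((E ^+ l)`_j * w ^+ j))); last first.
  rewrite -big_distrr/= exprMn -horner_exp [X in _ <= _ * X]mulrAC.
  rewrite [X in _ <= X]mulrA ler_wpM2l ?mulr_ge0 ?exprn_ge0 ?invr_ge0 ?(ltW a0) ?(ltW lf0)//.
  by apply: sum_coef_le_horner => // i; exact: coef_exp_ge0.
apply: ler_sum => j _; have jn : (j <= n)%N by rewrite -ltnS.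
have e0 : 0 <= (E ^+ l)`_j by exact: coef_exp_ge0.
have h1 : ('C(k, l) * 'C(k - l, n - j))%:R <= k%:R ^+ l / l`!%:R * 'C(k, n - j)%:R :> R.
  rewrite mulrAC ler_pdivlMr// -natrX -!natrM ler_nat; exact: bin_mul_le.
have h2 : 'C(k, n - j)%:R <= 'C(k, n)%:R * (n%:R / (k - n)%:R) ^+ j :> R.
  rewrite expr_div_n mulrA ler_pdivlMr ?exprn_gt0// -!natrX -!natrM ler_nat.
  by apply: bin_sub_le; rewrite jn ltnW.
have -> : w ^+ j = (n%:R / (k - n)%:R) ^+ j / a ^+ j.
  by rewrite /w invfM mulrCA [_^-1 * _]mulrC exprMn exprVn.
have -> : a ^+ n = a ^+ (n - j) * a ^+ j by rewrite -exprD subnK.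
have aj : 0 < a ^+ j by rewrite exprn_gt0.
have anj : 0 <= a ^+ (n - j) by rewrite exprn_ge0// ltW.
set W := (n%:R / _) ^+ j.
have -> : 'C(k, n)%:R * (a ^+ (n - j) * a ^+ j) * (k%:R ^+ l / l`!%:R) *
   ((E ^+ l)`_j * (W / a ^+ j)) = (E ^+ l)`_j * (k%:R ^+ l / l`!%:R * ('C(k, n)%:R * W))
     * a ^+ (n - j).
  by field; rewrite !gt_eqF.
by rewrite ler_wpM2r// ler_wpM2l// (le_trans h1)// ler_wpM2l// divr_ge0//.
Qed.

(** The product of the 1 - i/n over i < j is at least 1 minus the sum of the i/n, and j (j - 1)/2 is
    rounded up to j^2/2. Beyond j = n the left side is nonpositive. *)
Lemma ffact_ge (R : realType) (n j : nat) : (0 < n)%N ->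
  n%:R ^+ j * (1 - j%:R ^+ 2 / (2 * n%:R)) <= (n ^_ j)%:R :> R.
Proof.
move=> n0; have n0' : 0 < n%:R :> R by rewrite ltr0n.
elim: j => [|j ih]; first by rewrite expr0 expr0n/= mul0r subr0 mul1r.
have [nj|jn] := leqP n j.
  apply: (@le_trans _ _ 0) => //; apply: mulr_ge0_le0; first by rewrite exprn_ge0.
  rewrite subr_le0 ler_pdivlMr ?mulr_gt0// mul1r.
  have : n.+1%:R <= j.+1%:R :> R by rewrite ler_nat.
  have : 1 <= n%:R :> R by rewrite ler1n.
  by rewrite -!natr1; nra.
rewrite ffactnSr natrM natrB ?(ltnW jn)//.
have jn' : j%:R + 1 <= n%:R :> R by rewrite natr1 ler_nat.
apply: (@le_trans _ _ (n%:R ^+ j * (1 - j%:R ^+ 2 / (2 * n%:R)) * (n%:R - j%:R))).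
  rewrite exprSr -[X in X <= _]mulrA -[X in _ <= X]mulrA ler_wpM2l ?exprn_ge0//.
  have j0 : 0 <= j%:R :> R by [].
  rewrite -natr1 -subr_ge0.
  have -> : (1 - j%:R ^+ 2 / (2 * n%:R)) * (n%:R - j%:R) -
     n%:R * (1 - (j%:R + 1) ^+ 2 / (2 * n%:R)) = 2^-1 + j%:R ^+ 3 / (2 * n%:R) :> R.
    by field; rewrite gt_eqF.
  by rewrite addr_ge0// divr_ge0// ?mulr_ge0 ?exprn_ge0// ltW.
by rewrite ler_wpM2r// subr_ge0; lra.
Qed.

(** The right side is k! / (l! (n-2l)! (k-n+l)!). Relative to C(k,n) it gains the falling factorial
    of n of length 2l, estimated by [ffact_ge], and loses l! (k-n+l)!/(k-n)!, where the quotient is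
    at most k^l because l <= n. *)
Lemma bin_mul_ge (R : realType) (k n l : nat) : (0 < n <= k)%N -> (2 * l <= n)%N ->
  'C(k, n)%:R * (n%:R ^+ 2 / k%:R) ^+ l / l`!%:R * (1 - 2 * l%:R ^+ 2 / n%:R)
   <= ('C(k, l) * 'C(k - l, n - 2 * l))%:R :> R.
Proof.
move=> /andP[n0 nk] ln.
have k0 : 0 < k%:R :> R by rewrite ltr0n (leq_trans n0).
have lf0 : 0 < l`!%:R :> R by rewrite ltr0n fact_gt0.
have N : ('C(k, n) * n ^_ (2 * l) <= 'C(k, l) * 'C(k - l, n - 2 * l) * l`! * k ^ l)%N.
  rewrite -(@leq_pmul2r ((n - 2 * l)`! * (k - n + l)`!)) ?muln_gt0 ?fact_gt0//.
  have kl : (k - n + l <= k)%N by lia.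
  have -> : ('C(k, l) * 'C(k - l, n - 2 * l) * l`! * k ^ l *
     ((n - 2 * l)`! * (k - n + l)`!) = k`! * k ^ l)%N.
    rewrite -(@bin_fact k l); last by lia.
    rewrite -(@bin_fact (k - l) (n - 2 * l)); last by lia.
    have -> : (k - l - (n - 2 * l) = k - n + l)%N by lia.
    by ring.
  rewrite mulnA -(mulnA 'C(k, n)) ffact_fact// -(@bin_fact k n)// -!mulnA.
  rewrite !leq_mul2l; apply/orP; right; apply/orP; right.
  rewrite -(@ffact_fact (k - n + l) l) ?leq_addl// addnK mulnC leq_mul2l.
  apply/orP; right; apply: leq_trans (ffact_le_expn _ _) _.
  by case: (posnP l) => [->|l0]; rewrite ?expn0// leq_exp2r.
have h := @ffact_ge R n (2 * l) n0.
apply: (@le_trans _ _ ('C(k, n)%:R * (n ^_ (2 * l))%:R / k%:R ^+ l / l`!%:R)).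
  have -> : 2 * l%:R ^+ 2 / n%:R = (2 * l)%:R ^+ 2 / (2 * n%:R) :> R.
    by rewrite natrM; field; rewrite pnatr_eq0 -lt0n.
  rewrite expr_div_n -exprM mulrAC; rewrite ler_pM2r ?invr_gt0//.
  rewrite [X in X * _]mulrA mulrAC ler_pM2r ?invr_gt0 ?exprn_gt0//.
  by rewrite -mulrA ler_wpM2l.
rewrite ler_pdivrMr// ler_pdivrMr ?exprn_gt0// -natrX -!natrM ler_nat.
exact: N.
Qed.

(** Here [bin_mul_ge] yields the exponential series in [lam], each term damped by 1 - 2 l^2/n; the
    total damping is a second moment, controlled by [sum_sqr_exp_le]. *)
Lemma coef_exp1DD_ge (R : realType) (a : R) (F : {poly R}) (k n : nat) :
  let lam := F`_0 * n%:R ^+ 2 / (a ^+ 2 * k%:R) in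
  0 < a -> (forall i, 0 <= F`_i) -> (0 < n <= k)%N ->
  'C(k, n)%:R * a ^+ n * (expR lam * (1 - 2 * (lam ^+ 2 + lam) / n%:R)) <=
  ((1 + a *: 'X + 'X^2 * F) ^+ k)`_n.
Proof.
move=> lam a0 F0 /andP[n0 nk].
have n0' : 0 < n%:R :> R by rewrite ltr0n.
have k0 : 0 < k%:R :> R by rewrite ltr0n (leq_trans n0).
have E0 i : 0 <= ('X^2 * F)`_i by rewrite coefXnM; case: ifP.
have lam0 : 0 <= lam by rewrite divr_ge0// mulr_ge0// ?sqr_ge0// ltW.
(* The T l with l > k are nonpositive, so the partial sums up to k dominate the series. *)
pose T l := lam ^+ l / l`!%:R * (1 - 2 * l%:R ^+ 2 / n%:R).
have T_le m : (k <= m)%N -> \sum_(l < m.+1) T l <= \sum_(l < k.+1) T l.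
  move=> /subnK <-; elim: (m - k)%N => [|i ih]; first by rewrite add0n.
  rewrite addSn big_ord_recr/= -[X in _ <= X]addr0 lerD//.
  rewrite /T mulr_ge0_le0 ?divr_ge0 ?exprn_ge0// subr_le0 ler_pdivlMr// mul1r.
  have : n%:R <= (i + k).+1%:R :> R by rewrite ler_nat; lia.
  have : 1 <= n%:R :> R by rewrite ler1n.
  by move: (n%:R) ((i + k).+1%:R) => u v; nra.
have sumT : expR lam * (1 - 2 * (lam ^+ 2 + lam) / n%:R) <= \sum_(l < k.+1) T l.
  rewrite mulrBr mulr1 lerBlDr.
  apply: (@expR_le_sum _ _ _ k.+1) => -[|m]// km.
  rewrite -lerBlDr (le_trans _ (T_le m km))//.
  rewrite [X in _ <= X](_ : _ = \sum_(l < m.+1) lam ^+ l / l`!%:R -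
      2 / n%:R * \sum_(l < m.+1) l%:R ^+ 2 * (lam ^+ l / l`!%:R)).
    rewrite lerD2l lerN2.
    have := @sum_sqr_exp_le R lam m.+1 lam0.
    move=> h; have : 0 <= 2 / n%:R :> R by rewrite divr_ge0.
    move=> c0; apply: (le_trans (ler_wpM2l c0 h)).
    by rewrite le_eqVlt; apply/orP; left; apply/eqP; ring.
  rewrite big_distrr/= -sumrB; apply: eq_bigr => l _; rewrite /T.
  ring.
(* In the inner sum only j = 2 l is kept: there (X^2 F)^l has coefficient F(0)^l. *)
rewrite coef_exp1DD.
apply: (@le_trans _ _ (\sum_(l < k.+1) 'C(k, n)%:R * a ^+ n * T l)).
  by rewrite -big_distrr/= ler_wpM2l// mulr_ge0// exprn_ge0// ltW.
apply: ler_sum => l _.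
have term0 (j : 'I_n.+1) : 0 <= (('X^2 * F) ^+ l)`_j *
    ('C(k, l) * 'C(k - l, n - j))%:R * a ^+ (n - j).
  by rewrite mulr_ge0 ?exprn_ge0 ?(ltW a0)// mulr_ge0// coef_exp_ge0.
have [ln|nl] := leqP (2 * l) n; last first.
  apply: (@le_trans _ _ 0); last by apply: sumr_ge0.
  apply: mulr_ge0_le0; first by rewrite mulr_ge0// exprn_ge0// ltW.
  rewrite /T mulr_ge0_le0 ?divr_ge0 ?exprn_ge0// subr_le0 ler_pdivlMr// mul1r.
  have : n.+1%:R <= 2 * l%:R :> R by rewrite -natrM ler_nat.
  have : 1 <= n%:R :> R by rewrite ler1n.
  by rewrite -natr1; move: (n%:R) (l%:R) => u v; nra.
have lt2 : (2 * l < n.+1)%N by [].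
rewrite (bigD1 (Ordinal lt2))//= -[X in X <= _]addr0 lerD//; last first.
  by apply: sumr_ge0.
have -> : (('X^2 * F) ^+ l)`_(2 * l) = F`_0 ^+ l.
  rewrite exprMn -exprM coefXnM ltnn subnn.
  by rewrite -!horner_coef0 horner_exp.
have al : 0 < a ^+ (n - 2 * l) by rewrite exprn_gt0.
have a2l : 0 < a ^+ 2 ^+ l by rewrite !exprn_gt0.
have -> : a ^+ n = a ^+ (n - 2 * l) * a ^+ 2 ^+ l by rewrite -exprM -exprD subnK.
rewrite [X in X <= _](_ : _ = F`_0 ^+ l * ('C(k, n)%:R * (n%:R ^+ 2 / k%:R) ^+ l / l`!%:R
   * (1 - 2 * l%:R ^+ 2 / n%:R)) * a ^+ (n - 2 * l)).
  rewrite ler_wpM2r ?(ltW al)// ler_wpM2l ?exprn_ge0//.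
  by apply: bin_mul_ge => //; rewrite n0.
rewrite /T /lam invfM.
have -> : (F`_0 * n%:R ^+ 2 * ((a ^+ 2)^-1 / k%:R)) ^+ l =
   F`_0 ^+ l * (n%:R ^+ 2 / k%:R) ^+ l / a ^+ 2 ^+ l.
  by rewrite -exprMn -expr_div_n; congr (_ ^+ _); field; rewrite !gt_eqF.
have lf0 : l`!%:R != 0 :> R by rewrite pnatr_eq0 -lt0n fact_gt0.
by field; rewrite lf0 !gt_eqF.
Qed.

(** * The count as a coefficient of a power of Q *)

(* For i = 0 this is Q(w) = t! w^t R_t(1/w); in general it is (w d/dw)^i Q. *)
Definition ffact_poly (R : realType) (i t : nat) : {poly R} :=
  \poly_(j < t.+1) (j ^ i * t ^_ j)%:R.

(** The factor F in Q(w) = 1 + t w + w^2 F(w), which is zero for t = 1. *)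
Definition ffact_tail (R : realType) (t : nat) : {poly R} :=
  \poly_(j < t.-1) (t ^_ j.+2)%:R.

Lemma ffact_poly_decomp (R : realType) (t : nat) : (0 < t)%N ->
  ffact_poly R 0 t = 1 + t%:R *: 'X + 'X^2 * ffact_tail R t.
Proof.
move=> t0; apply/polyP => i.
rewrite !coefD coef1 coefZ coefX coefXnM !coef_poly expn0 mul1n.
case: i => [|[|i]] //=; first by rewrite mulr0 !addr0.
  by rewrite add0r mulr1 addr0 ltnS t0 ffactn1.
rewrite mulr0 !add0r subn2 /=; congr (if _ then _ else _).
by apply/idP/idP; lia.
Qed.

Lemma coef_exp_ffun (R : comNzRingType) (c : nat -> R) (T k n : nat) :
  ((\poly_(j < T) c j) ^+ k)`_n =
  \sum_(f : {ffun 'I_k -> 'I_T} | (\sum_(i < k) f i == n)%N)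
    \prod_(i < k) c (f i).
Proof.
have -> : (\poly_(j < T) c j) ^+ k = \prod_(i < k) \sum_(j < T) (c j *: 'X^j).
  by rewrite poly_def prodr_const card_ord.
rewrite bigA_distr_bigA/= coef_sum [RHS]big_mkcond/=; apply: eq_bigr => f _.
have -> : \prod_(i < k) (c (f i) *: 'X^(f i)) =
    (\prod_(i < k) c (f i)) *: 'X^(\sum_(i < k) f i)%N.
  by rewrite scaler_prod prodrXr.
by rewrite coefZ coefXn eq_sym; case: eqP => _; rewrite ?mulr1 ?mulr0.
Qed.

Lemma inv_factB (R : realType) (t j : nat) : (j <= t)%N ->
  ((t - j)`!%:R)^-1 = t`!%:R^-1 * (t ^_ j)%:R :> R.
Proof.
move=> jt; rewrite -(ffact_fact jt) natrM invfM -mulrA mulrCA.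
by rewrite mulVf ?mulr1// pnatr_eq0 -lt0n ffact_gt0.
Qed.

(** The involution replacing each entry d by t - d turns the sum N into t k - N and the weight 1/d!
    into a coefficient of Q divided by t!. *)
Lemma Ccount_coef (R : realType) (N t k : nat) : (N <= t * k)%N ->
  Ccount R N t k = t`!%:R^-1 ^+ k * ((ffact_poly R 0 t) ^+ k)`_(t * k - N).
Proof.
move=> Ntk; rewrite coef_exp_ffun big_distrr/= /Ccount.
pose rv (f : {ffun 'I_k -> 'I_t.+1}) := [ffun i => rev_ord (f i)].
have rvK : involutive rv by move=> f; apply/ffunP => i; rewrite !ffunE rev_ordK.
rewrite (reindex_inj (inv_inj rvK))/=; apply: eq_big => f.
  have E : (\sum_(i < k) rv f i + \sum_(i < k) f i = t * k)%N.
    rewrite -big_split/= (eq_bigr (fun=> t)) ?sum_nat_const ?card_ord 1?mulnC// => i _.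
    by rewrite ffunE /= subSS subnK// -ltnS.
  move: (\sum_(i < k) rv f i)%N (\sum_(i < k) f i)%N E => a b E.
  by apply/eqP/eqP => h; lia.
move=> _; rewrite -prodfV -[X in _ ^+ X](card_ord k) -prodr_const -big_split/=.
apply: eq_bigr => i _; rewrite ffunE /= subSS expn0 mul1n inv_factB//.
by rewrite -ltnS.
Qed.

(** * Polynomials with nonnegative coefficients on [0, 1] *)

(** For w in [0, 1] every power w^i with i >= 1 is at most w. *)
Lemma horner_le1 (R : realType) (p : {poly R}) (w : R) :
  (forall i, 0 <= p`_i) -> 0 <= w <= 1 -> p.[w] <= p`_0 + w * p.[1].
Proof.
move=> p0 /andP[w0 w1].
rewrite (horner_coef_wide w (leqnSn _)) (horner_coef_wide 1 (leqnSn _)).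
rewrite big_ord_recl/= expr0 mulr1 lerD2l big_distrr/= big_ord_recl/=.
apply: (@le_trans _ _ (\sum_(i < size p) w * (p`_(lift ord0 i) * 1 ^+ lift ord0 i))).
  apply: ler_sum => i _; rewrite expr1n mulr1 mulrC ler_wpM2r//.
  by rewrite -[X in _ <= X]expr1 ler_wiXn2l.
by rewrite lerDr mulr_ge0// mulr_ge0// exprn_ge0.
Qed.

Lemma horner_le2 (R : realType) (p : {poly R}) (w : R) :
  (forall i, 0 <= p`_i) -> 0 <= w <= 1 ->
  p.[w] <= p`_0 + p`_1 * w + w ^+ 2 * p.[1].
Proof.
move=> p0 /andP[w0 w1].
have sp : (size p <= (size p).+2)%N by lia.
rewrite (horner_coef_wide w sp) (horner_coef_wide 1 sp).
rewrite big_ord_recl big_ord_recl/= expr0 mulr1 expr1 addrA lerD2l big_distrr/=.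
rewrite big_ord_recl big_ord_recl/= .
apply: (@le_trans _ _ (\sum_(i < size p) w ^+ 2 * (p`_(lift ord0 (lift ord0 i)) * 1 ^+ lift ord0 (lift ord0 i)))).
  apply: ler_sum => i _; rewrite expr1n mulr1 mulrC ler_wpM2r//.
  by rewrite ler_wiXn2l.
by rewrite addrA lerDr addr_ge0// mulr_ge0 ?sqr_ge0// mulr_ge0// exprn_ge0.
Qed.

(** * The saddle function and its derivative in the variable w = 1/r *)

Lemma sum_rev_fact (R : realType) (g : nat -> R) (t : nat) (r : R) : 0 < r ->
  \sum_(d < t.+1) g (t - d)%N * (r ^+ d / d`!%:R) =
  r ^+ t / t`!%:R * \sum_(j < t.+1) g j * (t ^_ j)%:R * r^-1 ^+ j.
Proof.
move=> r0; rewrite (reindex_inj rev_ord_inj)/= big_distrr/=.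
apply: eq_bigr => j _; have jt : (j <= t)%N by rewrite -ltnS.
rewrite subSS subKn// inv_factB//.
have -> : r ^+ (t - j) = r ^+ t * r^-1 ^+ j.
  by rewrite -[in r ^+ t](subnK jt) exprD -mulrA -exprMn divff ?expr1n ?mulr1// gt_eqF.
ring.
Qed.

(** This is (x d/dx)^i R_t; the convention 0^0 = 1 makes the case i = 0 equal to R_t. *)
Definition fact_poly (R : realType) (i t : nat) : {poly R} :=
  \poly_(d < t.+1) (d%:R ^+ i / d`!%:R).

Lemma fact_polyE (R : realType) (i t : nat) (x : R) :
  (fact_poly R i t).[x] = \sum_(d < t.+1) d%:R ^+ i * (x ^+ d / d`!%:R).
Proof. by rewrite horner_poly; apply: eq_bigr => d _; rewrite mulrAC mulrA. Qed.

Lemma truncexp_poly (R : realType) (t : nat) : truncexp t = horner (fact_poly R 0 t).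
Proof.
by apply/funext => x; rewrite fact_polyE; apply: eq_bigr => d _; rewrite expr0 mul1r.
Qed.

Lemma fact_poly_deriv (R : realType) (i t : nat) (x : R) :
  x * (fact_poly R i t)^`().[x] = (fact_poly R i.+1 t).[x].
Proof.
rewrite -[x in x * _]hornerX -hornerM; congr (_.[x]); apply/polyP => -[|j].
  by rewrite coefXM/= coef_poly/= expr0n mul0r.
rewrite coefXM/= coef_deriv !coef_poly; case: ifP => _; last by rewrite mul0rn.
by rewrite [j.+1%:R ^+ i.+1]exprS -[RHS]mulrA mulr_natl.
Qed.

Lemma truncexp_gt0 (R : realType) (t : nat) (x : R) : 0 <= x -> 0 < truncexp t x.
Proof.
move=> x0; rewrite /truncexp big_ord_recl/= expr0 divr1 ltr_wpDr//.
by apply: sumr_ge0 => i _; rewrite divr_ge0// exprn_ge0.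
Qed.

Lemma saddle_funE (R : realType) (t : nat) :
  saddle_fun t = (fun x : R => (fact_poly R 1 t).[x] / (fact_poly R 0 t).[x]).
Proof.
by apply/funext => x; rewrite /saddle_fun truncexp_poly -derivE fact_poly_deriv.
Qed.

(** For the probability law on 0, ..., t with weights proportional to r^d / d!, [saddle_fun] is the
    mean and r times its derivative is the variance. *)
Lemma saddle_fun_derive (R : realType) (t : nat) (r : R) : 0 < r ->
  r * derive1 (saddle_fun t) r = (fact_poly R 2 t).[r] / truncexp t r
    - (saddle_fun t r) ^+ 2.
Proof.
move=> r0; have T0 := @truncexp_gt0 R t r (ltW r0).
rewrite saddle_funE derive1E.
have -> : (fun x : R => (fact_poly R 1 t).[x] / (fact_poly R 0 t).[x]) =
  horner (fact_poly R 1 t) * (fun x => (horner (fact_poly R 0 t) x)^-1) by [].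
have P0 : (fact_poly R 0 t).[r] != 0 by rewrite -truncexp_poly gt_eqF.
have h : is_derive r (1 : R) (horner (fact_poly R 0 t)) (fact_poly R 0 t)^`().[r].
  exact: is_derive_poly.
have h' := is_deriveV P0 h.
have h'' := is_deriveM (is_derive_poly (fact_poly R 1 t) r) h'.
rewrite (@derive_val _ _ _ _ _ _ _ h'') /= truncexp_poly.
rewrite -!fact_poly_deriv /GRing.scale/=; field.
exact: P0.
Qed.

Lemma fact_poly_rev (R : realType) (i t : nat) (r : R) : 0 < r ->
  \sum_(d < t.+1) (t%:R - d%:R) ^+ i * (r ^+ d / d`!%:R) =
  r ^+ t / t`!%:R * (ffact_poly R i t).[r^-1].
Proof.
move=> r0; rewrite horner_poly.
under [X in _ = _ * X]eq_bigr do rewrite natrM natrX.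
rewrite -(sum_rev_fact (fun j => j%:R ^+ i))//.
by apply: eq_bigr => d _; rewrite natrB// -ltnS.
Qed.

Lemma truncexp_ffact (R : realType) (t : nat) (r : R) : 0 < r ->
  truncexp t r = r ^+ t / t`!%:R * (ffact_poly R 0 t).[r^-1].
Proof.
move=> r0; rewrite -fact_poly_rev//.
by apply: eq_bigr => d _; rewrite expr0 mul1r.
Qed.

Lemma ffact_poly0_gt0 (R : realType) (t : nat) (w : R) : 0 <= w ->
  0 < (ffact_poly R 0 t).[w].
Proof.
move=> w0; rewrite horner_poly big_ord_recl/= !mul1n ffactn0 expr0 mulr1.
by rewrite ltr_wpDr// sumr_ge0// => j _; rewrite mulr_ge0// exprn_ge0.
Qed.

Lemma saddle_fun_ffact (R : realType) (t : nat) (r : R) : 0 < r ->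
  saddle_fun t r =
  t%:R - (ffact_poly R 1 t).[r^-1] / (ffact_poly R 0 t).[r^-1].
Proof.
move=> r0.
have Q0 : 0 < (ffact_poly R 0 t).[r^-1] by rewrite ffact_poly0_gt0// invr_ge0 ltW.
have c0 : 0 < r ^+ t / t`!%:R by rewrite divr_gt0 ?exprn_gt0// ltr0n fact_gt0.
rewrite saddle_funE -truncexp_poly truncexp_ffact//.
have := fact_poly_rev 1 t r0; move: c0; set c := r ^+ t / _ => c0 E.
have {E} : t%:R * truncexp t r - (fact_poly R 1 t).[r] = c * (ffact_poly R 1 t).[r^-1].
  rewrite -E fact_polyE /truncexp big_distrr -sumrB; apply: eq_bigr => d _.
  by rewrite /= !expr1 mulrBl.
rewrite truncexp_ffact// -/c => E.
have -> : (fact_poly R 1 t).[r] =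
    c * (t%:R * (ffact_poly R 0 t).[r^-1] - (ffact_poly R 1 t).[r^-1]).
  by rewrite mulrBr -E; ring.
by field; rewrite !gt_eqF.
Qed.

(** The variance is unchanged under the reversal d -> t - d. *)
Lemma saddle_fun_derive_ffact (R : realType) (t : nat) (r : R) : 0 < r ->
  r * derive1 (saddle_fun t) r =
  (ffact_poly R 2 t).[r^-1] / (ffact_poly R 0 t).[r^-1] -
  ((ffact_poly R 1 t).[r^-1] / (ffact_poly R 0 t).[r^-1]) ^+ 2.
Proof.
move=> r0; rewrite saddle_fun_derive//.
have Q0 : 0 < (ffact_poly R 0 t).[r^-1] by rewrite ffact_poly0_gt0// invr_ge0 ltW.
have c0 : 0 < r ^+ t / t`!%:R by rewrite divr_gt0 ?exprn_gt0// ltr0n fact_gt0.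
have E2 := fact_poly_rev 2 t r0.
have T0 := truncexp_gt0 t (ltW r0).
have {E2} : t%:R ^+ 2 * truncexp t r - 2 * t%:R * (fact_poly R 1 t).[r]
     + (fact_poly R 2 t).[r] = r ^+ t / t`!%:R * (ffact_poly R 2 t).[r^-1].
  rewrite -E2 !fact_polyE /truncexp !big_distrr -sumrB -big_split; apply: eq_bigr => d _.
  by rewrite /= !expr1; ring.
have -> : (fact_poly R 1 t).[r] = truncexp t r * saddle_fun t r.
  by rewrite saddle_funE truncexp_poly mulrCA divff ?mulr1// -truncexp_poly gt_eqF.
rewrite saddle_fun_ffact// truncexp_ffact//.
move: c0; set c := r ^+ t / _ => c0 E.
have -> : (fact_poly R 2 t).[r] = c * (ffact_poly R 2 t).[r^-1] -
   (t%:R ^+ 2 * (c * (ffact_poly R 0 t).[r^-1]) -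
    2 * t%:R * (c * (ffact_poly R 0 t).[r^-1] *
    (t%:R - (ffact_poly R 1 t).[r^-1] / (ffact_poly R 0 t).[r^-1]))).
  by rewrite -E; ring.
by field; rewrite !gt_eqF.
Qed.

(** * Estimates at the saddle point *)

Lemma ffact_poly_coef_ge0 (R : realType) (i t j : nat) : 0 <= (ffact_poly R i t)`_j.
Proof. by rewrite coef_poly; case: ifP. Qed.

Lemma ffact_tail_coef_ge0 (R : realType) (t j : nat) : 0 <= (ffact_tail R t)`_j.
Proof. by rewrite coef_poly; case: ifP. Qed.

Lemma ffact_tail_coef0 (R : realType) (t : nat) : (0 < t)%N ->
  (ffact_tail R t)`_0 = t%:R * (t%:R - 1).
Proof.
case: t => // t _; rewrite coef_poly /=.
case: t => [|t] /=; first by rewrite subrr mulr0.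
by rewrite !ffactnS ffactn0 muln1/= natrM -[t.+2%:R]natr1 addrK.
Qed.

Lemma horner_ge0 (R : realType) (p : {poly R}) (w : R) :
  (forall i, 0 <= p`_i) -> 0 <= w -> 0 <= p.[w].
Proof. by move=> p0 w0; rewrite (le_trans _ (sum_coef_le_horner 0 p0 w0))// big_ord0. Qed.

(** The weight j^(i+1) kills the constant term and leaves t as linear coefficient, so all moments of
    positive order agree to first order in w. *)
Lemma ffact_poly_lin (R : realType) (i t : nat) (w : R) : (0 < t)%N -> 0 <= w <= 1 ->
  t%:R * w <= (ffact_poly R i.+1 t).[w] <= t%:R * w + w ^+ 2 * (ffact_poly R i.+1 t).[1].
Proof.
move=> t0 /andP[w0 w1].
have c0 : (ffact_poly R i.+1 t)`_0 = 0 by rewrite coef_poly/= exp0n// mul0n.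
have c1 : (ffact_poly R i.+1 t)`_1 = t%:R.
  by rewrite coef_poly ltnS t0 exp1n mul1n ffactn1.
have P0 := @ffact_poly_coef_ge0 R i.+1 t.
have := sum_coef_le_horner 2 P0 w0.
rewrite !big_ord_recl big_ord0/= c0 c1 mul0r add0r expr1 addr0 => ->/=.
have := @horner_le2 R _ w P0.
by rewrite w0 w1 c0 c1 add0r; apply.
Qed.

(** At the saddle this reads Q(w) <= 1 + d Q(w), an a priori bound on Q(w). *)
Lemma ffact_poly01_ge (R : realType) (t : nat) (w : R) : 0 <= w ->
  (ffact_poly R 0 t).[w] <= 1 + (ffact_poly R 1 t).[w].
Proof.
move=> w0; rewrite !horner_poly !big_ord_recl/= ffactn0 expr0.
rewrite expn0 (expn1 0) mul1n mul0n mul0r add0r mulr1 lerD2l.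
apply: ler_sum => j _; rewrite /bump leq0n add1n expn0 expn1 ler_wpM2r ?exprn_ge0//.
by rewrite ler_nat leq_mul2r orbT.
Qed.

(** With x = u + a u^2 + e, the three parts of the constant bound e, x^2 - u^2 and x^3, the last two
    through x - u <= (1 + K) u^2 and x <= (2 + K) u. *)
Lemma ln1D_quadratic (R : realType) (a K u e : R) : 0 <= u <= 1 -> 0 <= a <= 1 ->
  0 <= K -> 0 <= e <= K * u ^+ 3 ->
  `|ln (1 + (u + a * u ^+ 2 + e)) - (u + (a - 2^-1) * u ^+ 2)| <=
  (K + (1 + K) * (3 + K) + (2 + K) ^+ 3) * u ^+ 3.
Proof.
move=> /andP[u0 u1] /andP[a0 a1] K0 /andP[e0 eK].
set x := u + a * u ^+ 2 + e.
have u2 : 0 <= u ^+ 2 by rewrite sqr_ge0.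
have u3 : 0 <= u ^+ 3 by rewrite exprn_ge0.
have u32 : u ^+ 3 <= u ^+ 2 by rewrite ler_wiXn2l.
have u21 : u ^+ 2 <= u by rewrite -[X in _ <= X]expr1 ler_wiXn2l.
have au : 0 <= a * u ^+ 2 <= u ^+ 2 by rewrite mulr_ge0//= ler_piMl.
have Ku : K * u ^+ 3 <= K * u ^+ 2 by rewrite ler_wpM2l.
have Ku' : K * u ^+ 2 <= K * u by rewrite ler_wpM2l.
case/andP: au => au0 au2.
have xu : u <= x by rewrite /x; lra.
have xu2 : x - u <= (1 + K) * u ^+ 2 by rewrite /x; lra.
have x2u : x <= (2 + K) * u by rewrite /x; lra.
have x0 : 0 <= x by apply: le_trans xu.
have x3 : x ^+ 3 <= (2 + K) ^+ 3 * u ^+ 3.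
  by rewrite -exprMn lerXn2r// nnegrE// mulr_ge0//; lra.
have x2 : 0 <= x ^+ 2 - u ^+ 2 <= (1 + K) * (3 + K) * u ^+ 3.
  rewrite subr_sqr; apply/andP; split; first by rewrite mulr_ge0//; lra.
  have -> : (1 + K) * (3 + K) * u ^+ 3 = ((1 + K) * u ^+ 2) * ((3 + K) * u) by ring.
  by rewrite ler_pM//; lra.
case/andP: x2 => x2l x2u'.
have x3' : 0 <= x ^+ 3 by rewrite exprn_ge0.
have := ln1D_ge x0; have := ln1D_le x0.
move: (ln (1 + x)) => l h1 h2.
have -> : l - (u + (a - 2^-1) * u ^+ 2) = l - (x - x ^+ 2 / 2) + e - (x ^+ 2 - u ^+ 2) / 2.
  by rewrite /x; field.
rewrite ler_norml !mulrDl; apply/andP; split; lra.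
Qed.

(** The function u - d ln u is stationary at u = d, so a relative error h = O(d) in u changes it
    only by d (h - ln (1 + h)) = O(d^3). *)
Lemma sub_ln_quadratic (R : realType) (B d u : R) : 0 < d -> 0 <= B ->
  B * d <= 2^-1 -> `|u - d| <= B * d ^+ 2 ->
  `|(u - d * ln u) - (d - d * ln d)| <= 2 * B ^+ 2 * d ^+ 3.
Proof.
move=> d0 B0 Bd ud; pose h := u / d - 1.
have uE : u = d * (1 + h) by rewrite /h; field; rewrite gt_eqF.
have hB : `|h| <= B * d.
  rewrite -(ler_pM2l d0) -{1}(gtr0_norm d0) -normrM.
  have -> : d * h = u - d by rewrite uE; ring.
  by rewrite (le_trans ud)// le_eqVlt; apply/orP; left; apply/eqP; ring.
have h2 : `|h| <= 2^-1 by apply: le_trans Bd.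
have h1 : 0 < 1 + h by move: h2; rewrite ler_norml => /andP[? ?]; lra.
have hq : h ^+ 2 <= B ^+ 2 * d ^+ 2.
  by rewrite -exprMn -real_normK ?num_real// lerXn2r// nnegrE// mulr_ge0// ltW.
have key : 0 <= h - ln (1 + h) <= 2 * h ^+ 2.
  rewrite subr_ge0 le_ln1Dx ?andTb; last by lra.
  have [h0|h0] := leP 0 h.
    by have := ln1D_ge h0; have := sqr_ge0 h; lra.
  have := @ln1B_ge R (- h); rewrite opprK sqrrN => H.
  suff : h - 2 * h ^+ 2 <= ln (1 + h) by lra.
  by apply: H; move: h2; rewrite ler_norml => /andP[? ?]; apply/andP; split; lra.
rewrite {1 2}uE lnM ?posrE//.
have -> : d * (1 + h) - d * (ln d + ln (1 + h)) - (d - d * ln d) = d * (h - ln (1 + h)).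
  by ring.
case/andP: key => k1 k2; rewrite ger0_norm ?mulr_ge0 ?(ltW d0)//.
have -> : 2 * B ^+ 2 * d ^+ 3 = d * (2 * (B ^+ 2 * d ^+ 2)) by ring.
by rewrite ler_pM2l// (le_trans k2)// ler_pM2l.
Qed.

(** First Q(w) <= 1 + 2 d gives u = t w <= 2 d, and then |u - d| <= B d^2. Next, ln Q(w) is expanded
    to second order in u, and u is replaced by d, at cost O(d^3) by stationarity. For the variance,
    the first two moments differ by O(w^2). *)
Lemma saddle_point_estimates (R : realType) (t : nat) : (0 < t)%N ->
  exists2 C : R, 0 < C & forall d w : R, 0 < d -> 0 < w -> C * d <= 1 ->
    (ffact_poly R 1 t).[w] / (ffact_poly R 0 t).[w] = d ->
    `|ln (ffact_poly R 0 t).[w] - d * ln w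
      - (d - d * ln (d / t%:R) + (2^-1 - t%:R^-1) * d ^+ 2)| <= C * d ^+ 3 /\
    `|(ffact_poly R 2 t).[w] / (ffact_poly R 0 t).[w] - d ^+ 2 - d| <= C * d ^+ 2.
Proof.
move=> t0.
have t1 : 1 <= t%:R :> R by rewrite ler1n.
have P1 i j : 0 <= (ffact_poly R i t)`_j := ffact_poly_coef_ge0 _ _ _ _.
pose K0 := (ffact_tail R t).[1].
have K00 : 0 <= K0 by apply: horner_ge0 => // j; exact: ffact_tail_coef_ge0.
pose K1 := (ffact_poly R 1 t).[1].
have K10 : 0 <= K1 by exact: horner_ge0.
pose K2 := (ffact_poly R 2 t).[1].
have K20 : 0 <= K2 by exact: horner_ge0.
(* The bound u - d <= 2 d^2 comes from Q(w) <= 1 + 2 d, and d - u <= 4 K1 d^2 from the quadratic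
   remainder w^2 K1 with w <= 2 d. *)
pose B := 4 * K1 + 2.
pose CK := K0 + (1 + K0) * (3 + K0) + (2 + K0) ^+ 3.
have CK0 : 0 <= CK by rewrite /CK !addr_ge0// ?mulr_ge0 ?exprn_ge0//; lra.
(* In order: stationarity of u - d ln u, replacing u^2 by d^2, the cubic remainder of ln Q with u <=
   2 d, and the variance estimate. *)
pose C := 2 * B ^+ 2 + 3 / 2 * B + 8 * CK + (4 * (K1 + K2) + 1).
have B2 : 2 <= B by rewrite /B; lra.
have BB : 0 <= B ^+ 2 by rewrite sqr_ge0.
exists C; first by rewrite /C; lra.
move=> d w d0 w0 Cd E.
have Q0 := ffact_poly0_gt0 t (ltW w0).
have q1 : (ffact_poly R 1 t).[w] = d * (ffact_poly R 0 t).[w].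
  by rewrite -E divfK// gt_eqF.
have q0le := ffact_poly01_ge t (ltW w0).
have Bd : 2 * B <= C by rewrite /C; nra.
have Bd2 : B * d <= 2^-1 by nra.
have d4 : d <= 2^-1 by nra.
have q02 : (ffact_poly R 0 t).[w] <= 1 + 2 * d by nra.
have dec : (ffact_poly R 0 t).[w] = 1 + t%:R * w + w ^+ 2 * (ffact_tail R t).[w].
  by rewrite ffact_poly_decomp// !hornerD hornerC hornerZ hornerX hornerM hornerXn.
have Fw : 0 <= (ffact_tail R t).[w].
  by apply: horner_ge0 => [j|]; [exact: ffact_tail_coef_ge0|exact: ltW].
pose u := t%:R * w.
have u0 : 0 < u by rewrite mulr_gt0 ?ltr0n.
have wu : w <= u by rewrite ler_peMl// ltW.
have w2F : 0 <= w ^+ 2 * (ffact_tail R t).[w] by rewrite mulr_ge0 ?sqr_ge0.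
have q01 : 1 + u <= (ffact_poly R 0 t).[w] by rewrite dec /u; lra.
have u2d : u <= 2 * d by lra.
have w1 : 0 <= w <= 1 by apply/andP; split; lra.
have [+ +] := (andP (ffact_poly_lin 0 t0 w1), andP (ffact_poly_lin 1 t0 w1)).
rewrite -/u -/K1 -/K2 => -[l1 u1] [l2 u2].
have w24 : w ^+ 2 <= 4 * d ^+ 2 by nra.
have K1w : w ^+ 2 * K1 <= 4 * d ^+ 2 * K1 by rewrite ler_wpM2r.
have K2w : w ^+ 2 * K2 <= 4 * d ^+ 2 * K2 by rewrite ler_wpM2r.
have d2 : 0 < d ^+ 2 by rewrite exprn_gt0.
have d3 : 0 < d ^+ 3 by rewrite exprn_gt0.
have ud : `|u - d| <= B * d ^+ 2.
  have : d <= d * (ffact_poly R 0 t).[w] by rewrite ler_peMr ?(ltW d0)//; lra.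
  have : d * (ffact_poly R 0 t).[w] <= d * (1 + 2 * d) by rewrite ler_pM2l.
  rewrite q1 in l1 u1; move: l1 u1 K1w q02 d0 d2; clear => l1 u1 K1w q02 d0 d2 h1 h2.
  by rewrite ler_norml /B; apply/andP; split; lra.
split; last first.
  have -> : (ffact_poly R 2 t).[w] / (ffact_poly R 0 t).[w] - d ^+ 2 - d =
     ((ffact_poly R 2 t).[w] - (ffact_poly R 1 t).[w]) / (ffact_poly R 0 t).[w] - d ^+ 2.
    by rewrite q1; field; rewrite gt_eqF.
  apply: (le_trans (ler_normB _ _)); rewrite [`|d ^+ 2|]ger0_norm ?(ltW d2)//.
  rewrite normrM normfV [`|(ffact_poly R 0 t).[w]|]ger0_norm ?(ltW Q0)//.
  have : `|(ffact_poly R 2 t).[w] - (ffact_poly R 1 t).[w]| / (ffact_poly R 0 t).[w]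
     <= 4 * (K1 + K2) * d ^+ 2.
    rewrite ler_pdivrMr//; apply: (@le_trans _ _ (4 * (K1 + K2) * d ^+ 2)).
      move: l1 u1 l2 u2 K1w K2w d2 K10 K20; clear => l1 u1 l2 u2 K1w K2w d2 K10 K20.
      by rewrite ler_norml; apply/andP; split; lra.
    rewrite ler_peMr//; last by lra.
    by apply: mulr_ge0; [lra|exact: ltW].
  have : (4 * (K1 + K2) + 1) * d ^+ 2 <= C * d ^+ 2.
    by rewrite ler_pM2r// /C; lra.
  by lra.
have lw : ln w = ln u - ln t%:R.
  by rewrite /u lnM ?posrE ?ltr0n// addrC addKr.
rewrite lw ln_div ?posrE ?ltr0n//.
(* With this a, the term w^2 F(0) = t (t - 1) w^2 equals a u^2; [e] below is the rest of w^2
   F(w). *)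
pose a := 1 - t%:R^-1 : R.
have tV0 : 0 <= t%:R^-1 :> R by rewrite invr_ge0.
have tV1 : t%:R^-1 <= 1 :> R by rewrite invf_le1 ?ltr0n ?ler1n.
pose e := w ^+ 2 * ((ffact_tail R t).[w] - (ffact_tail R t)`_0).
have e0 : 0 <= e <= K0 * u ^+ 3.
  have F0 := sum_coef_le_horner 1 (@ffact_tail_coef_ge0 R t) (ltW w0).
  rewrite big_ord_recl big_ord0 expr0 addr0 mulr1 /= in F0.
  have F1 := horner_le1 (@ffact_tail_coef_ge0 R t) w1.
  rewrite mulr_ge0 ?sqr_ge0 ?subr_ge0//=.
  apply: (@le_trans _ _ (w ^+ 2 * (w * K0))).
    by rewrite ler_wpM2l ?sqr_ge0// lerBlDl.
  by rewrite mulrA -exprSr mulrC ler_wpM2l// lerXn2r// nnegrE ltW.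
have dec' : (ffact_poly R 0 t).[w] = 1 + (u + a * u ^+ 2 + e).
  rewrite dec /e /a /u ffact_tail_coef0//; field.
  by rewrite pnatr_eq0 -lt0n.
have A := @ln1D_quadratic R a K0 u e _ _ K00 e0.
rewrite -dec' -/CK in A.
have {}A : `|ln (ffact_poly R 0 t).[w] - (u + (a - 2^-1) * u ^+ 2)| <= CK * u ^+ 3.
  apply: A.
    by rewrite (ltW u0) (le_trans u2d)//; move: d4; clear; lra.
  by rewrite subr_ge0 tV1 gerBl.
have B' := @sub_ln_quadratic R B d u d0 _ Bd2 ud.
have {}B' := B' (le_trans (ltW (ltr0n _ 2)) B2).
have D : `|(a - 2^-1) * (u ^+ 2 - d ^+ 2)| <= 3 / 2 * B * d ^+ 3.
  have -> : (a - 2^-1) * (u ^+ 2 - d ^+ 2) = (a - 2^-1) * (u - d) * (u + d) by ring.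
  have -> : 3 / 2 * B * d ^+ 3 = 2^-1 * (B * d ^+ 2) * (3 * d) by field.
  rewrite !normrM ler_pM ?mulr_ge0// ?ler_pM//.
    by rewrite /a ler_norml; move: tV0 tV1; clear => ? ?; apply/andP; split; lra.
  rewrite ger0_norm; first by move: u2d; clear; lra.
  by rewrite ltW// addr_gt0.
have u8 : CK * u ^+ 3 <= 8 * CK * d ^+ 3.
  have : u ^+ 3 <= (2 * d) ^+ 3 by rewrite lerXn2r// nnegrE ?mulr_ge0// ltW.
  move=> h; apply: (le_trans (ler_wpM2l CK0 h)).
  by rewrite le_eqVlt; apply/orP; left; apply/eqP; ring.
have -> : ln (ffact_poly R 0 t).[w] - d * (ln u - ln t%:R) -
  (d - d * (ln d - ln t%:R) + (2^-1 - t%:R^-1) * d ^+ 2) =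
  (ln (ffact_poly R 0 t).[w] - (u + (a - 2^-1) * u ^+ 2)) +
  ((u - d * ln u) - (d - d * ln d)) + (a - 2^-1) * (u ^+ 2 - d ^+ 2).
  by rewrite /a; field; rewrite pnatr_eq0 -lt0n.
apply: (le_trans (ler_normD _ _)); apply: (le_trans (lerD (ler_normD _ _) (lexx _))).
have : 0 <= (4 * (K1 + K2) + 1) * d ^+ 3 by rewrite mulr_ge0 ?(ltW d3)// addr_ge0// mulr_ge0// addr_ge0.
have -> : C * d ^+ 3 = 2 * B ^+ 2 * d ^+ 3 + 3 / 2 * B * d ^+ 3 + 8 * CK * d ^+ 3 +
   (4 * (K1 + K2) + 1) * d ^+ 3 by rewrite /C; ring.
by move: A B' D u8; clear; lra.
Qed.

(** * Logarithm of the falling factorial *)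

Lemma ln_ffact (R : realType) (n k : nat) : (0 < k)%N -> (2 * n <= k)%N ->
  `|ln (k ^_ n)%:R - (n%:R * ln k%:R - n%:R ^+ 2 / (2 * k%:R))| <=
  n%:R / k%:R + 2 * (n%:R ^+ 3 / k%:R ^+ 2) :> R.
Proof.
move=> k0; have k0' : 0 < k%:R :> R by rewrite ltr0n.
pose c : R := k%:R^-1.
have c0 : 0 < c by rewrite invr_gt0.
(* Each new factor 1 - n/k satisfies - x - 2 x^2 <= ln (1 - x) <= - x with x = n/k. The induction
   keeps the exact sum n (n - 1)/2, and its gap to n^2/2 goes into the error n/k. *)
suff H : (2 * n <= k)%N -> n%:R * ln k%:R - n%:R * (n%:R - 1) / 2 * c
    - 2 * n%:R ^+ 3 * c ^+ 2 <= ln (k ^_ n)%:R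
    <= n%:R * ln k%:R - n%:R * (n%:R - 1) / 2 * c.
  move=> /H /andP[]; rewrite invfM -exprVn -/c.
  have nc : 0 <= n%:R * c by rewrite mulr_ge0// ltW.
  have nc3 : 0 <= n%:R ^+ 3 * c ^+ 2 by rewrite mulr_ge0 ?sqr_ge0 ?exprn_ge0.
  move: (ln _) => l h1 h2.
  by rewrite ler_norml; apply/andP; split; lra.
elim: n => [_|n ih nk]; first by rewrite ln1 expr0n/= !mul0r; apply/andP; split; lra.
have {ih}/andP[l u] : _ := ih (leq_trans (leq_mul (leqnn 2) (leqnSn n)) nk).
have nk' : (n < k)%N by lia.
have x2 : 0 <= n%:R * c <= 2^-1.
  rewrite mulr_ge0 ?(ltW c0)//= ler_pdivrMr//.
  have : 2 * n.+1%:R <= k%:R :> R by rewrite -natrM ler_nat.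
  by rewrite -[n.+1%:R]natr1; lra.
have -> : ln (k ^_ n.+1)%:R = ln (k ^_ n)%:R + (ln k%:R + ln (1 - n%:R * c)).
  rewrite ffactnSr natrM lnM ?posrE ?ltr0n ?subn_gt0 ?ffact_gt0//; last exact: ltnW.
  rewrite natrB ?(ltnW nk')//; congr (_ + _).
  rewrite -lnM ?posrE//; last by move: x2 => /andP[? ?]; lra.
  by congr ln; rewrite /c; field; rewrite gt_eqF.
have := @ln1B_ge R _ x2.
have : ln (1 - n%:R * c) <= - (n%:R * c).
  by rewrite le_ln1Dx//; move: x2 => /andP[? ?]; lra.
rewrite exprMn -[n.+1%:R]natr1; set a := ln (1 - _); set b := n%:R.
have b0 : 0 <= b by rewrite /b.
have cc : 0 <= c ^+ 2 by rewrite sqr_ge0.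
have bc : 0 <= b * c ^+ 2 by rewrite mulr_ge0.
have bbc : 0 <= b ^+ 2 * c ^+ 2 by rewrite mulr_ge0 ?sqr_ge0.
move=> h1 h2; rewrite -/b in l u.
by apply/andP; split; lra.
Qed.

(** * Existence of the saddle point *)

Lemma saddle_fun_surj (R : realType) (t : nat) (d : R) : 0 < d < t%:R ->
  exists2 r : R, 0 < r & saddle_fun t r = t%:R - d.
Proof.
move=> /andP[d0 dt].
pose K1 := (ffact_poly R 1 t).[1].
have P1 := @ffact_poly_coef_ge0 R 1 t.
have K10 : 0 <= K1 by exact: horner_ge0.
(* At r = 1/w the mean of t - d' under the weights r^d'/d'! is at most w K1, and this w makes w K1
   <= d. The intermediate value theorem then applies on [0, 1/w]. *)
pose w := d / (K1 + d).
have Kd : 0 < K1 + d by rewrite ltr_wpDl.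
have w0 : 0 < w by rewrite divr_gt0.
have w1 : 0 <= w <= 1 by rewrite ltW//= ler_pdivrMr// mul1r lerDr.
have M0 : 0 < w^-1 by rewrite invr_gt0.
have f0 : saddle_fun t 0 = 0 :> R by rewrite /saddle_fun !mul0r.
have fM : t%:R - d <= saddle_fun t w^-1.
  rewrite saddle_fun_ffact// invrK lerD2l lerN2.
  have Q1 : 1 <= (ffact_poly R 0 t).[w].
    have := sum_coef_le_horner 1 (@ffact_poly_coef_ge0 R 0 t) (ltW w0).
    by rewrite big_ord_recl big_ord0 /= addr0 expr0 mulr1 coef_poly/= ffactn0.
  rewrite ler_pdivrMr ?(lt_le_trans _ Q1)//.
  apply: (@le_trans _ _ d); last by rewrite ler_peMr// ltW.
  apply: (le_trans (horner_le1 P1 w1)); rewrite coef_poly/= mul0n add0r -/K1.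
  by rewrite /w mulrAC ler_pdivrMr// ler_pM2l// lerDl ltW.
have cf : {within `[0, w^-1], continuous (saddle_fun t : R -> R)}.
  rewrite saddle_funE; apply: continuous_in_subspaceT => x.
  rewrite inE/= in_itv/= => /andP[x0 _].
  apply: cvgM; first exact: continuous_horner.
  apply: cvgV; last exact: continuous_horner.
  by rewrite -truncexp_poly gt_eqF// truncexp_gt0.
have yM : 0 < t%:R - d by lra.
have [|r rM rE] := @IVT R (saddle_fun t) 0 w^-1 (t%:R - d) (ltW M0) cf.
  rewrite f0; apply/andP; split.
    by rewrite ge_min (ltW yM).
  by rewrite le_max fM orbT.
exists r => //; move: rM; rewrite in_itv/= => /andP[r0 _].
rewrite lt0r r0 andbT; apply/eqP => r00; move: rE; rewrite r00 f0; lra.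
Qed.

Lemma r0P (R : realType) (t : nat) (d : R) : 0 < d < t%:R ->
  0 < r0 t (t%:R - d) /\ saddle_fun t (r0 t (t%:R - d)) = t%:R - d.
Proof.
move=> /saddle_fun_surj [r rp rE].
rewrite /r0; apply: (@xgetPex _ 0 [set r | 0 < r /\ saddle_fun t r = t%:R - d]).
by exists r.
Qed.

(** * Asymptotics of the coefficient *)

Lemma expRB1_le (R : realType) (z e : R) : 0 <= e <= 2^-1 -> `|z| <= e ->
  `|expR z - 1| <= 2 * e.
Proof.
move=> /andP[e0 e2]; rewrite ler_norml => /andP[z1 z2].
have l := expR_ge1Dx z; have u := expR_ge1Dx (- z).
have p := expR_gt0 z; have E := expRxMexpNx_1 z.
rewrite ler_norml; apply/andP; split; first by lra.
have : expR z * (1 - z) <= expR z * expR (- z) by rewrite ler_pM2l.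
rewrite E => h.
by nra.
Qed.

(** The two coefficient bounds are applied with a = t and E = X^2 F; both have main exponent [lam] =
    F(0) n^2 / (t^2 k). *)
Lemma coef_ln_estimate (R : realType) (t : nat) : (0 < t)%N ->
  exists2 C : R, 0 < C & forall n k : nat, (0 < n)%N -> (0 < k)%N ->
    let d : R := n%:R / k%:R in
    C * (d + k%:R * d ^+ 3) <= 1 ->
    0 < ((ffact_poly R 0 t) ^+ k)`_n /\
    `|ln ((ffact_poly R 0 t) ^+ k)`_n -
      (ln 'C(k, n)%:R + n%:R * ln t%:R + (1 - t%:R^-1) * (k%:R * d ^+ 2))|
      <= C * (d + k%:R * d ^+ 3).
Proof.
move=> t0.
have t1 : 1 <= t%:R :> R by rewrite ler1n.
pose K0 := (ffact_tail R t).[1].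
have K00 : 0 <= K0 by apply: horner_ge0 => // j; exact: ffact_tail_coef_ge0.
(* The upper bound contributes 8 x, from 1/(1 - d)^2 in the main term, and 8 K0 x, from F(w) - F(0);
   the lower bound contributes 8 (d + x). *)
exists (8 + 8 * K0); first by lra.
move=> n k n0 k0 d.
have n0' : 0 < n%:R :> R by rewrite ltr0n.
have k0' : 0 < k%:R :> R by rewrite ltr0n.
have d0 : 0 < d by rewrite divr_gt0.
have nE : n%:R = d * k%:R by rewrite /d divfK// gt_eqF.
pose x := k%:R * d ^+ 3; rewrite -/x => Cx.
have x0 : 0 < x by rewrite mulr_gt0// exprn_gt0.
have K0d : 0 <= K0 * d by rewrite mulr_ge0// ltW.
have K0x : 0 <= K0 * x by rewrite mulr_ge0// ltW.
have dx8 : 8 * (d + x) <= 1 by lra.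
have d8 : d <= 8^-1 by lra.
have nk : (2 * n <= k)%N.
  by rewrite -(ler_nat R) natrM nE; nra.
have nk' : (n < k)%N by move: n0 nk; clear; lia.
have t0' : 0 < t%:R :> R by rewrite ltr0n.
have tn0 : t%:R != 0 :> R by rewrite gt_eqF.
have tV0 : 0 <= t%:R^-1 :> R by rewrite invr_ge0.
have tV1 : t%:R^-1 <= 1 :> R by rewrite invf_le1.
set c := ((ffact_poly R 0 t) ^+ k)`_n.
pose lam := (1 - t%:R^-1) * (k%:R * d ^+ 2); rewrite -/lam.
have kd2 : 0 < k%:R * d ^+ 2 by rewrite mulr_gt0// exprn_gt0.
have lam0 : 0 <= lam by rewrite mulr_ge0 ?(ltW kd2)// subr_ge0.
have lam_le : lam <= k%:R * d ^+ 2 by rewrite ler_piMl ?(ltW kd2)//; lra.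
have F0E := ffact_tail_coef0 R t0.
have FP := @ffact_tail_coef_ge0 R t.
have C0 : 0 < 'C(k, n)%:R * t%:R ^+ n :> R.
  by rewrite mulr_gt0 ?exprn_gt0// ltr0n bin_gt0 ltnW.
have lnC : ln ('C(k, n)%:R * t%:R ^+ n) = ln 'C(k, n)%:R + n%:R * ln t%:R :> R.
  rewrite lnM ?posrE ?exprn_gt0// ?ltr0n ?bin_gt0 ?(ltnW nk')//.
  by rewrite lnXn// mulr_natl.
have up : c <= 'C(k, n)%:R * t%:R ^+ n * expR (lam + (8 + 8 * K0) * x).
  have := @coef_exp1DD_le R t%:R ('X^2 * ffact_tail R t) k n t0'.
  rewrite -ffact_poly_decomp// -/c => H; apply: (le_trans (H _ nk')).
    by move=> i; rewrite coefXnM; case: ifP.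
  rewrite ler_pM2l// ler_expR natrB ?(ltnW nk')//.
  set w := n%:R / _.
  have d1 : 0 < 1 - d by lra.
  have wE : w = d / t%:R / (1 - d).
    have kd : k%:R - n%:R = k%:R * (1 - d) by rewrite nE; ring.
    by rewrite /w kd nE; field; rewrite tn0 !gt_eqF.
  have dt0 : 0 < d / t%:R by rewrite divr_gt0.
  have w0 : 0 < w by rewrite wE divr_gt0.
  have wl : w <= d / t%:R * (1 + 2 * d).
    rewrite wE ler_pdivrMr// -[X in _ <= X]mulrA ler_peMr ?(ltW dt0)//.
    by nra.
  have dtd : d / t%:R <= d by rewrite ler_pdivrMr// ler_peMr// ltW.
  have w2d : w <= 2 * d.
    apply: (le_trans wl); apply: (@le_trans _ _ (d * (1 + 2 * d))).
      by rewrite ler_wpM2r// addr_ge0// mulr_ge0// ltW.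
    by move: d0 d8; clear; nra.
  have w1 : 0 <= w <= 1 by rewrite (ltW w0)/=; lra.
  rewrite hornerM hornerXn.
  have Fw := horner_le1 FP w1; rewrite -/K0 F0E in Fw.
  apply: (@le_trans _ _ (k%:R * (w ^+ 2 * (t%:R * (t%:R - 1) + w * K0)))).
    by rewrite ler_pM2l// ler_wpM2l ?sqr_ge0.
  have h1 : w ^+ 2 <= (d / t%:R) ^+ 2 * (1 + 8 * d).
    apply: (@le_trans _ _ ((d / t%:R * (1 + 2 * d)) ^+ 2)).
      by rewrite lerXn2r// nnegrE ?(ltW w0)// mulr_ge0 ?(ltW dt0)// addr_ge0// mulr_ge0// ltW.
    by rewrite exprMn ler_wpM2l ?sqr_ge0//; move: d0 d8; clear; nra.
  have h2 : w ^+ 3 <= 8 * d ^+ 3.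
    rewrite (_ : 8 * d ^+ 3 = (2 * d) ^+ 3); last by ring.
    by rewrite lerXn2r// nnegrE; [exact: ltW|move: d0; clear; lra].
  have tt : 0 <= t%:R * (t%:R - 1) :> R by rewrite mulr_ge0// subr_ge0.
  have h3 : k%:R * (w ^+ 2 * (t%:R * (t%:R - 1))) <= lam + 8 * x.
    apply: (@le_trans _ _ (k%:R * ((d / t%:R) ^+ 2 * (1 + 8 * d) * (t%:R * (t%:R - 1))))).
      by rewrite ler_pM2l// ler_wpM2r.
    have -> : k%:R * ((d / t%:R) ^+ 2 * (1 + 8 * d) * (t%:R * (t%:R - 1))) =
        lam + 8 * d * lam by rewrite /lam; field.
    have : d * lam <= d * (k%:R * d ^+ 2) by rewrite ler_pM2l.
    have -> : d * (k%:R * d ^+ 2) = x by rewrite /x; ring.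
    by lra.
  have h4 : k%:R * K0 * w ^+ 3 <= 8 * K0 * x.
    apply: (@le_trans _ _ (k%:R * K0 * (8 * d ^+ 3))).
      by rewrite ler_wpM2l// mulr_ge0// ltW.
    by rewrite le_eqVlt; apply/orP; left; apply/eqP; rewrite /x; ring.
  have -> : k%:R * (w ^+ 2 * (t%:R * (t%:R - 1) + w * K0)) =
    k%:R * (w ^+ 2 * (t%:R * (t%:R - 1))) + k%:R * K0 * w ^+ 3 by ring.
  by lra.
(* Since [lam] <= k d^2, [lam] is at most d n and its square at most k^2 d^4 = x n. *)
have z4 : 2 * (lam ^+ 2 + lam) / n%:R <= 2 * (x + d).
  rewrite ler_pdivrMr// -mulrA ler_pM2l// mulrDl lerD//.
    have -> : x * n%:R = (k%:R * d ^+ 2) ^+ 2 by rewrite /x nE; ring.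
    by rewrite lerXn2r// nnegrE ?(ltW kd2).
  by apply: (le_trans lam_le); rewrite nE le_eqVlt; apply/orP; left; apply/eqP; ring.
have z0 : 0 <= 2 * (lam ^+ 2 + lam) / n%:R.
  by rewrite divr_ge0 ?(ltW n0')// mulr_ge0// addr_ge0// sqr_ge0.
have lo : 'C(k, n)%:R * t%:R ^+ n * (expR lam * (1 - 2 * (lam ^+ 2 + lam) / n%:R)) <= c.
  have := @coef_exp1DD_ge R t%:R (ffact_tail R t) k n.
  rewrite -ffact_poly_decomp//= -/c n0 (ltnW nk').
  have -> : (ffact_tail R t)`_0 * n%:R ^+ 2 / (t%:R ^+ 2 * k%:R) = lam.
    by rewrite F0E /lam nE; field; rewrite tn0 gt_eqF.
  by apply.
have z1 : 0 < 1 - 2 * (lam ^+ 2 + lam) / n%:R by lra.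
have c0 : 0 < c.
  by apply: lt_le_trans lo; rewrite (mulr_gt0 C0)// mulr_gt0// expR_gt0.
split=> //.
have lnup : ln c <= ln 'C(k, n)%:R + n%:R * ln t%:R + (lam + (8 + 8 * K0) * x).
  rewrite -lnC -[X in _ + X](expRK) -lnM ?posrE ?expR_gt0//.
  by rewrite ler_ln ?posrE// (mulr_gt0 C0)// expR_gt0.
have lnlo : ln 'C(k, n)%:R + n%:R * ln t%:R + (lam - 4 * (2 * (x + d))) <= ln c.
  have zz : 0 <= 2 * (lam ^+ 2 + lam) / n%:R <= 2^-1 by rewrite z0/=; lra.
  have := ln1B_ge zz; move: z4 zz z0 z1 lo; set z := 2 * (_ + _) / _ => z4 /andP[_ z2] z0 z1 lo lz.
  have zzz : z ^+ 2 <= z by rewrite -[X in _ <= X]expr1 ler_wiXn2l//; move: z2; clear; lra.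
  apply: (@le_trans _ _ (ln ('C(k, n)%:R * t%:R ^+ n * (expR lam * (1 - z))))).
    have e1 := expR_gt0 lam.
    rewrite (lnM C0 (mulr_gt0 e1 z1)) (lnM e1 z1).
    by rewrite expRK lnC; move: lz zzz z4 z0; clear; lra.
  by rewrite ler_ln ?posrE// (mulr_gt0 C0)// mulr_gt0// expR_gt0.
move: lnup lnlo K0d K0x d0 x0; clear => ? ? ? ? ? ?.
by rewrite ler_norml; apply/andP; split; lra.
Qed.

(** * Comparison of the count with the saddle point approximation *)

(** The inequality ln y <= y - 1 is used for y = s/d and for y = d/s. *)
Lemma ln_dist (R : realType) (a d s : R) : 0 < d -> 0 < s -> a <= 2^-1 ->
  `|s - d| <= a * d -> `|ln s - ln d| <= 2 * a.
Proof.
move=> d0 s0 a2; rewrite !ler_norml => /andP[l u].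
have a0 : 0 <= a by nra.
have B (x y : R) : 0 < x -> 0 < y -> ln x - ln y <= x / y - 1.
  move=> x0 y0; rewrite -ln_div ?posrE// -[X in ln X](subrKC 1) le_ln1Dx//.
  by have : 0 < x / y by [rewrite divr_gt0]; lra.
have h1 := B _ _ s0 d0; have h2 := B _ _ d0 s0.
have : s / d <= 1 + 2 * a by rewrite ler_pdivrMr//; nra.
have : d / s <= 1 + 2 * a by rewrite ler_pdivrMr//; nra.
by move=> ? ?; apply/andP; split; lra.
Qed.

(** The hypotheses are those under which all error terms, of order d + k d^3, are small; Stirling's
    formula for n! asks in addition that n be large. *)
Lemma Ccount_saddle_approx (R : realType) (t : nat) (eps : R) : (0 < t)%N -> 0 < eps ->
  exists2 eta : R, 0 < eta & \forall n \near \oo, forall k m : nat,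
    (0 < k)%N -> (2 * m + n = t * k)%N ->
    n%:R / k%:R <= eta -> k%:R * (n%:R / k%:R) ^+ 3 <= eta ->
    exists delta : R, `|delta| <= eps /\
      Ccount R (2 * m) t k = saddle_approx R t k m * (1 + delta).
Proof.
move=> t0 eps0.
have [C1 C10 H1] := saddle_point_estimates R t0.
have [C2 C20 H2] := coef_ln_estimate R t0.
pose e := Num.min (eps / 2) 2^-1.
have e0 : 0 < e by rewrite lt_min divr_gt0//=.
have e2 : e <= 2^-1 by rewrite ge_min lexx orbT.
have e1 : 2 * e <= eps.
  have : e <= eps / 2 by rewrite ge_min lexx.
  by lra.
have e40 : 0 < e / 4 by rewrite divr_gt0.
(* The bound C (d + x) <= e leaves e/4 for all errors other than Stirling's, which takes another
   e/4. *)
pose C := 4 * (C1 + C2 + 4).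
have C0 : 0 < C by rewrite /C; lra.
exists (e / (2 * C)); first by rewrite !divr_gt0// mulr_gt0.
near=> n => k m k0 mn.
set d := n%:R / k%:R; set x := k%:R * d ^+ 3 => dC xC.
have n0 : (0 < n)%N by near: n; exact: nbhs_infty_gt.
have St : `|ln n`!%:R - (ln (2 * pi * n%:R) / 2 + n%:R * ln n%:R - n%:R)| <= e / 4.
  by near: n; exact: ln_fact_stirling.
have t0' : 0 < t%:R :> R by rewrite ltr0n.
have t1 : 1 <= t%:R :> R by rewrite ler1n.
have n0' : 0 < n%:R :> R by rewrite ltr0n.
have k0' : 0 < k%:R :> R by rewrite ltr0n.
have d0 : 0 < d by rewrite divr_gt0.
have nE : n%:R = k%:R * d by rewrite /d mulrC divfK// gt_eqF.
have x0 : 0 < x by rewrite mulr_gt0// exprn_gt0.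
have Cdx : C * (d + x) <= e.
  have : C * (e / (2 * C)) = e / 2 by field; rewrite gt_eqF.
  have : C * d <= C * (e / (2 * C)) by rewrite ler_pM2l.
  have : C * x <= C * (e / (2 * C)) by rewrite ler_pM2l.
  by lra.
have C1d : 0 < C1 * d by rewrite mulr_gt0.
have C1x : 0 < C1 * x by rewrite mulr_gt0.
have C2d : 0 < C2 * d by rewrite mulr_gt0.
have C2x : 0 < C2 * x by rewrite mulr_gt0.
have Cdx' : C1 * d + C1 * x + C2 * d + C2 * x + 4 * d + 4 * x <= e / 4.
  by move: Cdx; rewrite /C; clear; lra.
have C1d1 : C1 * d <= 2^-1 by move: Cdx' e2 C1x C2d C2x d0 x0; clear; lra.
have C2dx : C2 * (d + x) <= 1 by move: Cdx' e2 C1d C1x d0 x0; clear; lra.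
have d2 : d <= 2^-1 by move: Cdx' e2 C1d C1x C2d C2x x0; clear; lra.
have nk : (2 * n <= k)%N.
  by rewrite -(ler_nat R) natrM nE; move: d2 k0'; clear; nra.
have yE : (2 * m)%:R / k%:R = t%:R - d.
  apply: (mulIf (lt0r_neq0 k0')); rewrite divfK ?gt_eqF// mulrBl.
  by rewrite [d * _]mulrC -nE -natrM -mn natrD addrK.
have dt : 0 < d < t%:R by rewrite d0/= (lt_le_trans _ t1)// (le_lt_trans d2)// invf_lt1 ?ltr1n.
have [rp rE] := r0P dt.
rewrite /saddle_approx yE /s_fun; move: rp rE; set r := r0 t _ => rp rE.
rewrite saddle_fun_derive_ffact//.
have Qd : (ffact_poly R 1 t).[r^-1] / (ffact_poly R 0 t).[r^-1] = d.
  by move: rE; rewrite saddle_fun_ffact// => /addrI /oppr_inj.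
have w0 : 0 < r^-1 by rewrite invr_gt0.
have Q0 := ffact_poly0_gt0 t (ltW w0).
have C1d1' : C1 * d <= 1 by move: C1d1; clear; lra.
have [h1 h2] := H1 d r^-1 d0 w0 C1d1' Qd.
rewrite Qd.
move: h2; set s := _ / _ - d ^+ 2 => h2.
have C1dd : C1 * d ^+ 2 = C1 * d * d by ring.
have s0 : 0 < s by move: h2 C1dd C1d1 d0; rewrite ler_norml; clear => /andP[? ?]; nra.
have [c0 h3] := H2 n k n0 k0 C2dx.
rewrite -/d -/x in h3.
have := ln_ffact R k0 nk; rewrite -/d => h4.
have N : (2 * m <= t * k)%N by rewrite -mn leq_addr.
rewrite Ccount_coef//.
have -> : (t * k - 2 * m = n)%N by rewrite -mn addKn.
move: c0 h3; set c := ((ffact_poly R 0 t) ^+ k)`_n => c0 h3.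
have f0 : 0 < t`!%:R :> R by rewrite ltr0n fact_gt0.
set S := Num.sqrt _.
have pks : 0 < 2 * pi * k%:R * s by rewrite !mulr_gt0// pi_gt0.
have S0 : 0 < S by rewrite sqrtr_gt0.
(* The factor t!^-k is common to both sides, and r^(t k) / r^(2 m) = r^n. *)
pose D := S^-1 * ((ffact_poly R 0 t).[r^-1] ^+ k * r ^+ n).
have D0 : 0 < D by rewrite mulr_gt0 ?invr_gt0// mulr_gt0// exprn_gt0.
have -> : S^-1 * (truncexp t r ^+ k / r ^+ (2 * m)) = t`!%:R^-1 ^+ k * D.
  rewrite truncexp_ffact// /D !exprMn -exprM -mn exprD.
  by field; rewrite !gt_eqF// exprn_gt0.
pose z := ln c - ln D.
have zE : expR z = c / D by rewrite expRB !lnK.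
exists (expR z - 1); split; last first.
  by rewrite zE; field; rewrite !gt_eqF.
apply: (le_trans _ e1); apply: expRB1_le; first by rewrite (ltW e0).
have lnS : ln S = ln (2 * pi * k%:R * s) / 2.
  by rewrite /S -powR12_sqrt ?(ltW pks)// ln_powR mulrC.
have lnD : ln D = - (ln (2 * pi * k%:R * s) / 2) +
    k%:R * (ln (ffact_poly R 0 t).[r^-1] - d * ln r^-1).
  have SV0 : 0 < S^-1 by rewrite invr_gt0.
  rewrite /D (lnM SV0 (mulr_gt0 (exprn_gt0 k Q0) (exprn_gt0 n rp))).
  rewrite (lnM (exprn_gt0 k Q0) (exprn_gt0 n rp)) (lnV S0) lnS !lnXn// (lnV rp).
  rewrite -[_ *+ k]mulr_natl -[_ *+ n]mulr_natl nE; ring.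
have lnks : `|ln (2 * pi * k%:R * s) - ln (2 * pi * n%:R)| <= 2 * (C1 * d).
  have -> : ln (2 * pi * k%:R * s) - ln (2 * pi * n%:R) = ln s - ln d.
    have p2 : 0 < 2 * pi :> R by rewrite mulr_gt0// pi_gt0.
    rewrite nE (lnM (mulr_gt0 p2 k0') s0) (lnM p2 k0') (lnM p2 (mulr_gt0 k0' d0)).
    by rewrite (lnM k0' d0); ring.
  by apply: ln_dist => //; rewrite -C1dd.
have lnbin : ln 'C(k, n)%:R = ln (k ^_ n)%:R - ln n`!%:R :> R.
  rewrite -bin_ffact natrM lnM ?posrE ?ltr0n ?fact_gt0 ?bin_gt0//; last by move: nk; clear; lia.
  by rewrite addrK.
have h1' : `|k%:R * (ln (ffact_poly R 0 t).[r^-1] - d * ln r^-1) -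
   (n%:R - n%:R * (ln n%:R - ln k%:R - ln t%:R) + (2^-1 - t%:R^-1) * (k%:R * d ^+ 2))|
   <= C1 * x.
  have -> : C1 * x = k%:R * (C1 * d ^+ 3) by rewrite /x; ring.
  rewrite -(ler_pM2l k0') in h1; apply: le_trans h1.
  rewrite -[X in _ <= X * _](gtr0_norm k0') -normrM le_eqVlt; apply/orP; left; apply/eqP.
  have -> : ln (d / t%:R) = ln n%:R - ln k%:R - ln t%:R.
    by rewrite ln_div ?posrE// /d ln_div ?posrE.
  by rewrite nE; congr (`|_|); ring.
have n2E : n%:R ^+ 2 / (2 * k%:R) = k%:R * d ^+ 2 / 2 by rewrite nE; field; rewrite gt_eqF.
have n3E : n%:R ^+ 3 / k%:R ^+ 2 = x by rewrite nE /x; field; rewrite gt_eqF.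
rewrite n2E n3E in h4; rewrite lnbin in h3.
rewrite /z lnD.
(* Once the logarithms are abstracted the main terms cancel linearly: the coefficients of k d^2
   match because (1 - 1/t) - 1/2 = 1/2 - 1/t. *)
move: lnks h1' h3 h4 St Cdx' C1d C1x C2d C2x d0 x0; clear.
rewrite !ler_norml.
move: (ln c) (ln n`!%:R) (ln (k ^_ n)%:R) => Lc Lf Lk.
move: (ln (2 * pi * k%:R * s)) (ln (2 * pi * n%:R)) (k%:R * (_ - _)) => Ls Ln Lq.
rewrite !mulrDr !mulrN.
move: (k%:R * d ^+ 2) (t%:R^-1) (n%:R * ln n%:R) (n%:R * ln k%:R) (n%:R * ln t%:R).
move=> kd tV nLn nlk nlt.
move=> /andP[? ?] /andP[? ?] /andP[? ?] /andP[? ?] /andP[? ?] ? ? ? ? ? ? ?.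
by apply/andP; split; lra.
Unshelve. all: by end_near.
Qed.

(** * From the window for 2m/k to the smallness of d and k d^3 *)

(** With q = k^(1/8) the window bounds become powers of q: d <= 8/q^3, hence k d^3 <= 512/q. Two
    square roots would not suffice: with q = k^(1/4) the same bound on k d^3 grows. *)
Lemma ln_le_root8 (R : realType) (x : R) : 1 < x ->
  exists q : R, [/\ 1 < q, x = q ^+ 8, Num.sqrt x = q ^+ 4 & 0 < ln x <= 8 * q].
Proof.
move=> x1; have x0 : 0 < x by apply: lt_trans x1.
pose q := Num.sqrt (Num.sqrt (Num.sqrt x)).
have q0 : 0 <= q by exact: sqrtr_ge0.
have q4 : Num.sqrt x = q ^+ 4.
  by rewrite -[4%N]/(2 * 2)%N exprM !sqr_sqrtr// sqrtr_ge0.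
have q8 : x = q ^+ 8.
  by rewrite -[8%N]/(4 * 2)%N exprM -q4 sqr_sqrtr// ltW.
have q1 : 1 < q.
  by rewrite -(ltr_pXn2r (_ : 0 < 8)%N) ?nnegrE// expr1n -q8.
exists q; split=> //; rewrite ln_gt0//= q8 lnXn; last by apply: lt_trans q1.
rewrite -[_ *+ 8]mulr_natl ler_pM2l// ltW// ln_sublinear//.
exact: lt_trans q1.
Qed.

Theorem theorem5 (R : realType) (t : nat) (ht : (1 <= t)%N) :
  forall eps : R, 0 < eps ->
  \forall k \near \oo, forall m : nat,
    t%:R - ln k%:R / Num.sqrt k%:R <= (2 * m)%:R / k%:R :> R ->
    (2 * m)%:R / k%:R <= t%:R - (Num.sqrt k%:R * ln k%:R)^-1 :> R ->
    exists delta : R, `|delta| <= eps /\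
      Ccount R (2 * m) t k = saddle_approx R t k m * (1 + delta).
Proof.
move=> eps eps0; have [eta eta0 [N0 _ H]] := Ccount_saddle_approx ht eps0.
(* The term 512/[eta] serves the bounds on d and k d^3, and 8 N0 ensures n >= N0. *)
pose A : R := 1 + 512 / eta + 8 * N0%:R.
have h5 : 0 <= 512 / eta by apply: divr_ge0; [exact: ler0n|exact: ltW].
have h8 : 0 <= N0%:R :> R by exact: ler0n.
have A1 : 1 <= A by rewrite /A; move: (512 / eta) (N0%:R : R) h5 h8 => u v; lra.
near=> k => m.
have kA : A ^+ 8 <= k%:R by near: k; exact: nbhs_infty_ger.
have k1 : 1 < k%:R :> R by rewrite ltr1n; near: k; exact: nbhs_infty_gt.
have [q [q1 kq aq /andP[L0 Lq]]] := ln_le_root8 k1.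
rewrite aq; move: L0 Lq; set L := ln _ => L0 Lq.
have q0 : 0 < q by apply: lt_trans q1.
have Aq : A <= q.
  rewrite -(ler_pXn2r (_ : 0 < 8)%N) ?nnegrE -?kq//; last exact: ltW.
  exact: le_trans A1.
have k0' : 0 < k%:R :> R by apply: lt_trans k1.
have k0 : (0 < k)%N by rewrite -(ltr0n R).
have q4 : 0 < q ^+ 4 by rewrite exprn_gt0.
have aL0 : 0 < q ^+ 4 * L by rewrite mulr_gt0.
move=> lo up.
(* The upper end of the window makes the truncated subtraction defining [n] exact. *)
have mk : (2 * m <= t * k)%N.
  have : (2 * m)%:R / k%:R <= t%:R :> R.
    by rewrite (le_trans up)// gerBl invr_ge0 ltW.
  by rewrite ler_pdivrMr// -natrM ler_nat.
pose n := (t * k - 2 * m)%N.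
have mn : (2 * m + n = t * k)%N by rewrite subnKC.
pose d : R := n%:R / k%:R.
have dE : d = t%:R - (2 * m)%:R / k%:R.
  rewrite /d /n natrB// [(t * k)%:R]natrM; field.
  by rewrite gt_eqF.
have d_up : d <= L / q ^+ 4 by rewrite dE; lra.
have d_lo : (q ^+ 4 * L)^-1 <= d by rewrite dE; lra.
have d0 : 0 < d by apply: lt_le_trans d_lo; rewrite invr_gt0.
have q3 : 0 < q ^+ 3 by rewrite exprn_gt0.
have d_up' : d <= 8 / q ^+ 3.
  apply: (le_trans d_up); rewrite ler_pdivrMr// mulrAC ler_pdivlMr//.
  have -> : 8 * q ^+ 4 = 8 * q * q ^+ 3 by ring.
  by rewrite ler_pM2r.
have N512 : 512 / q <= eta.
  rewrite ler_pdivrMr// mulrC -ler_pdivrMr//; apply: le_trans Aq.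
  by rewrite /A; move: (512 / eta) (N0%:R : R) h5 h8 => u v; lra.
have q8 : 8 / q ^+ 3 <= 512 / q.
  rewrite ler_pdivrMr// mulrAC ler_pdivlMr//.
  have -> : 512 * q ^+ 3 = 8 * q * (64 * q ^+ 2) by ring.
  rewrite -[8 * q in X in X <= _]mulr1 ler_pM2l ?mulr_gt0//.
  by have : 1 <= q ^+ 2 by [rewrite exprn_ege1// ltW]; lra.
apply: (H n _ k m k0 mn).
(* The lower bound on d gives n >= q^4 / L >= q^3/8, while q >= 8 N0. *)
- rewrite /= -(ler_nat R).
  have -> : n%:R = d * q ^+ 8 by rewrite -kq /d divfK// gt_eqF.
  apply: (@le_trans _ _ ((q ^+ 4 * L)^-1 * q ^+ 8)); last by rewrite ler_pM2r// exprn_gt0.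
  rewrite mulrC ler_pdivlMr//.
  have -> : q ^+ 8 = q ^+ 4 * (q ^+ 3 * q) by ring.
  rewrite mulrCA ler_pM2l//.
  apply: (@le_trans _ _ (N0%:R * (8 * q))); first by rewrite ler_wpM2l.
  rewrite mulrA ler_pM2r//; apply: (@le_trans _ _ q).
    apply: le_trans Aq; rewrite /A; move: (512 / eta) (N0%:R : R) h5 h8 => u v; lra.
  by rewrite -[X in X <= _]expr1 ler_weXn2l// ltW.
- exact: le_trans (le_trans d_up' q8) N512.
- rewrite -/d; apply: le_trans N512.
  have : d ^+ 3 <= (8 / q ^+ 3) ^+ 3 by rewrite lerXn2r// nnegrE ?divr_ge0// ltW.
  move=> h; apply: (le_trans (ler_wpM2l (ltW k0') h)).
  rewrite kq le_eqVlt; apply/orP; left; apply/eqP.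
  by field; rewrite gt_eqF.
Unshelve. all: by end_near.
Qed.
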